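(* Let $\aleph_2\le\kappa\le\lambda$ be regular cardinals and suppose that $\nu^{\omega}<\kappa$ for every cardinal $\nu$ with $\aleph_2\le\nu<\kappa$. Then the following are equivalent: (1) $\mathrm{Nm}(\kappa,\lambda)$ preserves the semistationarity of every semistationary subset of $[\lambda]^{\omega}$; (2) $\mathrm{SSR}([\lambda]^{\omega},{<}\kappa)$.
   Context: For a set $W\supseteq\omega_1$, $S\subseteq[W]^{\omega}$ is semistationary if $\{x\in[W]^\omega:\exists y\in S\,(y\subseteq x\wedge y\cap\omega_1=x\cap\omega_1)\}$ is stationary in $[W]^\omega$. $\mathcal{P}_\kappa\lambda=\{a\subseteq\lambda:|a|<\kappa\}$. $\mathrm{SSR}([\lambda]^{\omega},{<}\kappa)$: for every semistationary $S\subseteq[\lambda]^\omega$ there is $R\in\mathcal{P}_\kappa\lambda$ with $\omega_1\subseteq R$, $R\cap\kappa\in\kappa$, and $S\cap[R]^\omega$ semistationary in $[R]^\omega$. Namba forcing over $\mathcal{P}_\kappa\lambda$: for an ideal $I$ on $\mathcal{P}_\kappa\lambda$ with $I^+=\mathcal{P}(\mathcal{P}_\kappa\lambda)\setminus I$, consider finite $\subseteq$-increasing sequences $\langle a_0,\dots,a_{n-1}\rangle$ of elements of $\mathcal{P}_\kappa\lambda$, ordered by end-extension $s\sqsubseteq t$ ($s$ an initial segment of $t$); $s^\frown\langle a\rangle$ denotes the one-step extension (with $a$ containing all entries of $s$). An $I$-Namba tree is a set $p$ of such sequences closed under initial segments, having a trunk $\mathrm{tr}(p)$ (the $\sqsubseteq$-largest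 element of $p$ comparable with all elements of $p$), such that for each $s\in p$ with $\mathrm{tr}(p)\sqsubseteq s$, $\mathrm{Suc}_p(s)=\{a:s^\frown\langle a\rangle\in p\}\in I^+$. $\mathrm{Nm}(\kappa,\lambda,I)$ is the set of $I$-Namba trees ordered by inclusion, and $\mathrm{Nm}(\kappa,\lambda)=\mathrm{Nm}(\kappa,\lambda,J^{bd}_{\kappa\lambda})$, where $J^{bd}_{\kappa\lambda}$ is the bounded ideal on $\mathcal{P}_\kappa\lambda$ (the sets $A$ for which some $b\in\mathcal{P}_\kappa\lambda$ satisfies $b\not\subseteq a$ for all $a\in A$). *)

(* Defs.v *)
From HB Require Import structures.
From mathcomp Require Import all_boot all_order.
From mathcomp Require Import all_classical.

Set Implicit Arguments.
Unset Strict Implicit.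
Unset Printing Implicit Defensive.

Local Open Scope order_scope.
Local Open Scope classical_set_scope.
Local Open Scope card_scope.

(* Ordinals are the points of a well-ordered type O, and the ordinal a is
   identified with the set [below a] of its predecessors. *)

Definition well_ordered (d : Order.disp_t) (O : orderType d) : Prop :=
  wochoice.well_order (<=%O : rel O).

Definition card_lt (T U : Type) (A : set T) (B : set U) : Prop :=
  (A #<= B) /\ ~ (B #<= A).

Section Ordinals.
Context {d : Order.disp_t} {O : orderType d}.
Implicit Types (a : O) (W x y : set O) (S C : set (set O)).

Definition below a : set O := [set b | b < a].

(* The set of countable ordinals of O; it is the ordinal omega_1 as soon as O
   has an uncountable element.  Similarly for [omega2]. *)
Definition omega1 : set O := [set a | countable (below a)].

Definition omega2 : set O := [set a | below a #<= omega1].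

Definition is_cardinal a : Prop :=
  forall b, b < a -> card_lt (below b) (below a).

Definition is_regular a : Prop :=
  [/\ is_cardinal a, infinite_set (below a) &
      forall X : set O, X `<=` below a -> card_lt X (below a) ->
        exists2 b, b < a & forall c, X c -> c < b].

(* [W]^omega *)
Definition ctbl_subsets W : set (set O) :=
  [set x | x `<=` W /\ x #= [set: nat]].

Definition club W C : Prop :=
  [/\ C `<=` ctbl_subsets W,
      forall x, ctbl_subsets W x -> exists2 y, C y & x `<=` y &
      forall X : nat -> set O, (forall n, C (X n)) ->
        (forall n, X n `<=` X n.+1) -> C (\bigcup_n X n)].

Definition stationary W S : Prop := forall C, club W C -> C `&` S !=set0.

Definition semistationary W S : Prop :=
  stationary W [set x | ctbl_subsets W x /\
    exists y, [/\ S y, y `<=` x & y `&` omega1 = x `&` omega1]].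

Definition Pkl (kappa lambda : O) : set (set O) :=
  [set x | x `<=` below lambda /\ card_lt x (below kappa)].

Definition SSR (kappa lambda : O) : Prop :=
  forall S, S `<=` ctbl_subsets (below lambda) ->
    semistationary (below lambda) S ->
    exists R, [/\ Pkl kappa lambda R, omega1 `<=` R,
      exists2 a, a < kappa & R `&` below kappa = below a &
      semistationary R (S `&` ctbl_subsets R)].

Section Namba.
Variables kappa lambda : O.

Definition increasing_seq (s : seq (set O)) : Prop :=
  (forall i, (i < size s)%N -> Pkl kappa lambda (nth set0 s i)) /\
  (forall i j, (i <= j)%N -> (j < size s)%N -> nth set0 s i `<=` nth set0 s j).

Implicit Types (p : set (seq (set O))) (I : set (set (set O))).

Definition is_trunk p (t : seq (set O)) : Prop :=
  [/\ p t, forall s, p s -> prefix s t \/ prefix t s &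
      forall u : seq (set O), p u ->
        (forall s, p s -> prefix s u \/ prefix u s) -> prefix u t].

Definition Suc p (s : seq (set O)) : set (set O) := [set x | p (rcons s x)].

Definition positive I : set (set (set O)) :=
  [set A | A `<=` Pkl kappa lambda /\ ~ I A].

Definition Namba_tree I p : Prop :=
  [/\ p `<=` increasing_seq,
      forall s t : seq (set O), p t -> prefix s t -> p s &
      exists2 tr, is_trunk p tr &
        forall s, p s -> prefix tr s -> positive I (Suc p s)].

Definition bounded_ideal : set (set (set O)) :=
  [set A | A `<=` Pkl kappa lambda /\
    exists2 y, Pkl kappa lambda y & forall x, A x -> ~ (y `<=` x)].

Definition Nm : Type := {p : set (seq (set O)) | Namba_tree bounded_ideal p}.

Definition Nm_le (p q : Nm) : Prop := sval p `<=` sval q.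

End Namba.
End Ordinals.

(* The forcing relation of a preorder (P, le), where smaller is stronger.  A
   sentence of the forcing language is represented by the set of conditions
   that force it. *)

Section Forcing.
Context {P : Type}.
Variable le : P -> P -> Prop.

Definition fprop : Type := set P.

Definition fground (A : Prop) : fprop := [set p | A].

Definition fand (F G : fprop) : fprop := [set p | F p /\ G p].

Definition fimp (F G : fprop) : fprop :=
  [set p | forall q, le q p -> F q -> G q].

Definition fiff (F G : fprop) : fprop := fand (fimp F G) (fimp G F).

Definition fall (X : Type) (F : X -> fprop) : fprop :=
  [set p | forall x, F x p].

Definition fex (X : Type) (F : X -> fprop) : fprop :=
  [set p | forall q, le q p -> exists2 r, le r q & exists x, F x r].

(* A name for a subset of X is a set of pairs (condition, element), where X is
   either a ground-model type or itself a type of names.  As every subset of a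
   ground-model set X in the extension has a name of type [name X], and every
   set of such subsets one of type [name (name X)], quantifying over these
   types is quantifying over the power sets computed in the extension. *)
Definition name (X : Type) : Type := set (P * X).

(* [eqX] is the forced equality between the elements of X. *)
Definition fmem_for (X : Type) (eqX : X -> X -> fprop) (x : X) (A : name X)
    : fprop :=
  [set p | forall q, le q p -> exists2 r, le r q &
    exists s y, [/\ A (s, y), le r s & eqX x y r]].

Definition fmem (X : Type) : X -> name X -> fprop :=
  fmem_for (fun x y => fground (x = y)).

Definition fsub (X : Type) (A B : name X) : fprop :=
  fall (fun x => fimp (fmem x A) (fmem x B)).

Definition feq (X : Type) (A B : name X) : fprop :=
  fall (fun x => fiff (fmem x A) (fmem x B)).

Definition fmem2 (X : Type) : name X -> name (name X) -> fprop :=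
  fmem_for (@feq X).

Definition check (X : Type) (A : set X) : name X := [set px | A px.2].

Definition check2 (X : Type) (S : set (set X)) : name (name X) :=
  [set px | exists2 A, S A & px.2 = check A].

(* R is an injective function from A to omega *)
Definition finjection (X : Type) (A : name X) (R : name (X * nat)) : fprop :=
  fand (fall (fun a => fiff (fmem a A) (fex (fun n => fmem (a, n) R))))
 (fand (fall (fun a => fall (fun n => fall (fun m =>
          fimp (fand (fmem (a, n) R) (fmem (a, m) R)) (fground (n = m))))))
       (fall (fun a => fall (fun b => fall (fun n =>
          fimp (fand (fmem (a, n) R) (fmem (b, n) R)) (fground (a = b))))))).

Definition fcountable (X : Type) (A : name X) : fprop :=
  fex (fun R : name (X * nat) => finjection A R).

Definition fdenumerable (X : Type) (A : name X) : fprop :=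
  fex (fun R : name (X * nat) =>
    fand (finjection A R)
         (fall (fun n => fex (fun a => fmem (a, n) R)))).

(* A name for a subset of omega * X is a name for the sequence of its
   sections. *)
Definition section_name (X : Type) (A : name (nat * X)) (n : nat) : name X :=
  [set px | A (px.1, (n, px.2))].

Section Semistationary.
Context {d : Order.disp_t} {O : orderType d}.
Implicit Types (W x y : name O) (S C : name (name O)).

(* a < omega_1, with omega_1 computed in the extension *)
Definition fomega1 (a : O) : fprop := fcountable (check (below a)).

Definition fctbl_subset W x : fprop := fand (fsub x W) (fdenumerable x).

Definition fclub W C : fprop :=
  fand (fall (fun x => fimp (fmem2 x C) (fctbl_subset W x)))
 (fand (fall (fun x => fimp (fctbl_subset W x)
          (fex (fun y => fand (fmem2 y C) (fsub x y)))))
       (fall (fun X : name (nat * O) =>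
          fimp (fand (fall (fun n => fmem2 (section_name X n) C))
                     (fall (fun n =>
                        fsub (section_name X n) (section_name X n.+1))))
            (fall (fun z : name O =>
               fimp (fall (fun a => fiff (fmem a z)
                       (fex (fun n => fmem a (section_name X n)))))
                    (fmem2 z C)))))).

(* The set of sets that is to be stationary is given by its defining formula. *)
Definition fstationary W (F : name O -> fprop) : fprop :=
  fall (fun C => fimp (fclub W C) (fex (fun x => fand (fmem2 x C) (F x)))).

Definition fsemistationary W S : fprop :=
  fstationary W (fun x => fand (fctbl_subset W x)
    (fex (fun y => fand (fmem2 y S) (fand (fsub y x)
      (fall (fun a => fiff (fand (fmem a y) (fomega1 a))
                           (fand (fmem a x) (fomega1 a)))))))).

Definition forces_semistationary (W : set O) (S : set (set O)) : Prop :=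
  forall p : P, fsemistationary (check W) (check2 S) p.

Definition preserves_semistationary (W : set O) : Prop :=
  forall S : set (set O), S `<=` ctbl_subsets W ->
    semistationary W S -> forces_semistationary W S.

End Semistationary.
End Forcing.

(* Main.v *)
(* A subset S of [W]^omega is semistationary iff every h : W^{<omega} -> W^omega
   admits y in S whose closure under h has no new countable ordinals.

   (1) => (2).  If no R reflects S, take for every R of the required shape a
   function h_R that refutes the semistationarity of S in [R]^omega, and force
   with sequences (a_n) of such R.  In the extension the sets x closed under
   all h_{a_n} form a club.  Every y in S is contained in some a_n by
   genericity, and if y is contained in x, then so is its closure under
   h_{a_n}, which contains a new countable ordinal.

   (2) => (1).  If S reflects to R, then fewer than kappa many elements of S
   form a family Y that is still semistationary in [R]^omega.  Given a name of a
   club C, the second player in the game of y tries to build a condition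
   that forces all elements of a certain x in C that contains y to be in y if
   they are countable ordinals; the first player plays lower bounds for the next
   element of the Namba sequence.  The game is open for the first player.  If he
   wins for all y in Y, one sequence can be played against all his strategies
   at once, since the union of fewer than kappa bounds is a bound; applying
   semistationarity to the decisions made in this play yields a y whose
   strategy it defeats. *)

Require Import Defs.
From mathcomp Require Import all_boot all_order.
From mathcomp Require Import all_classical.

Set Implicit Arguments.
Unset Strict Implicit.
Unset Printing Implicit Defensive.

Import Order.TTheory.
Local Open Scope order_scope.
Local Open Scope classical_set_scope.
Local Open Scope card_scope.

(** * Cardinality *)

Lemma card_le_inj (T U : Type) (A : set T) (B : set U) (f : T -> U) :
  (forall a, A a -> B (f a)) ->
  (forall a a', A a -> A a' -> f a = f a' -> a = a') -> A #<= B.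
Proof.
move=> fAB finj.
have fi : {in A &, injective f}.
  by move=> a a' /set_mem Aa /set_mem Aa'; exact: finj.
have /card_eqPle[_ le1] := inj_card_eq fi.
apply: card_le_trans le1 _; apply: subset_card_le.
by move=> _ [a Aa <-]; exact: fAB.
Qed.

Lemma card_le_rel (T U : Type) (A : set T) (B : set U) (R : T -> U -> Prop) :
  (forall a, A a -> exists2 b, B b & R a b) ->
  (forall a a' b, A a -> A a' -> R a b -> R a' b -> a = a') -> A #<= B.
Proof.
move=> RAB Rinj.
have [->|/set0P[a0 Aa0]] := eqVneq A set0; first exact: card_ge0.
have [b0 _ _] := RAB _ Aa0.
have /choice[f fP] : forall a, exists b, A a -> B b /\ R a b.
  move=> a; have [/RAB[b Bb Rab]|nAa] := pselect (A a).
    by exists b.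
  by exists b0.
apply: (card_le_inj (f := f)) => [a /fP[]//|a a' Aa Aa' e].
have [_ r1] := fP _ Aa; have [_ r2] := fP _ Aa'.
by apply: (Rinj a a' (f a)) => //; rewrite e.
Qed.

(** The default value [u0] off [A] makes the injection a total function. *)
Lemma card_le_funP (T U : Type) (A : set T) (B : set U) (u0 : U) :
  A #<= B -> exists f : T -> U, (forall a, A a -> B (f a)) /\
     (forall a a', A a -> A a' -> f a = f a' -> a = a').
Proof.
move=> /card_leP[f].
exists (fun a =>
  if pselect (A a) is left Aa then val (f (SigSub (mem_set Aa))) else u0).
split=> [a Aa|a a' Aa Aa'].
  by case: pselect => // Aa'; exact: set_valP.
case: pselect => // Ha; case: pselect => // Ha' /val_inj.
by move=> /(@inj _ _ _ f); rewrite !in_setT => /(_ isT isT) [].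
Qed.

(** By Zorn there is a maximal partial injection from [A] to [B]; it is total on [A] or onto [B],
    since otherwise one more pair could be added. *)
Lemma card_le_total (T U : Type) (A : set T) (B : set U) :
  A #<= B \/ B #<= A.
Proof.
pose P (G : set (T * U)) := [/\ forall x, G x -> A x.1 /\ B x.2,
  forall a b b', G (a, b) -> G (a, b') -> b = b' &
  forall a a' b, G (a, b) -> G (a', b) -> a = a'].
have [F FP totF|G [[GAB Gf Gi] Gmax]] := @Zorn_bigcup _ P.
  split.
  - by move=> x [H /FP[+ _ _]] => /[apply].
  - move=> a b b' [H FH Hx] [H' FH' Hx'].
    have [/(_ _ Hx)|/(_ _ Hx')] := totF _ _ FH FH'.
      by move=> H1; have [_ + _] := FP _ FH'; apply; eassumption.
    by move=> H1; have [_ + _] := FP _ FH; apply; eassumption.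
  - move=> a b b' [H FH Hx] [H' FH' Hx'].
    have [/(_ _ Hx)|/(_ _ Hx')] := totF _ _ FH FH'.
      by move=> H1; have [_ _ +] := FP _ FH'; apply; eassumption.
    by move=> H1; have [_ _ +] := FP _ FH; apply; eassumption.
have [domA|] := pselect (forall a, A a -> exists b, G (a, b)).
  left; apply: (card_le_rel (R := fun a b => G (a, b))).
    by move=> a /domA[b Gab]; exists b => //; have [] := GAB _ Gab.
  by move=> a a' b _ _; exact: Gi.
move=> /existsNP[a0 /not_implyP[Aa0 nGa]].
right; apply: (card_le_rel (R := fun b a => G (a, b))); last first.
  by move=> b b' a _ _; exact: Gf.
move=> b Bb; apply: contrapT => nb.
have nGb a : ~ G (a, b).
  by move=> Gab; apply: nb; exists a => //; have [] := GAB _ Gab.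
have := Gmax (G `|` [set (a0, b)]); apply.
  split; first by move=> x; left.
  by move=> /(_ (a0, b)) sG; apply: nGa; exists b; apply: sG; right.
split.
- by move=> x [/GAB//|->].
- move=> a c c' [Gc|/pair_equal_spec[e1 e2]] [Gc'|/pair_equal_spec[ea ec]].
  + exact: Gf Gc Gc'.
  + by case: nGa; rewrite -ea; exists c.
  + by case: nGa; rewrite -e1; exists c'.
  + by rewrite e2 ec.
- move=> a a' c [Gc|/pair_equal_spec[e1 e2]] [Gc'|/pair_equal_spec[ea ec]].
  + exact: Gi Gc Gc'.
  + by case: (nGb a); rewrite -ec.
  + by case: (nGb a'); rewrite -e2.
  + by rewrite e1 ea.
Qed.

Lemma card_ltP (T U : Type) (A : set T) (B : set U) :
  card_lt A B <-> ~ (B #<= A).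
Proof.
split=> [[]//|nBA]; split=> //.
by have [|/nBA] := card_le_total A B.
Qed.

Lemma card_le_lt (T U V : Type) (A : set T) (B : set U) (C : set V) :
  A #<= B -> card_lt B C -> card_lt A C.
Proof.
move=> AB /card_ltP nCB; apply/card_ltP => CA; apply: nCB.
exact: card_le_trans CA AB.
Qed.

Lemma countable_range (I : countType) (T : Type) (u : I -> T) :
  countable (range u).
Proof. by apply: sub_countable (card_image_le _ _) _; exact: countableP. Qed.

(** Numbers outside the image of the injection [f] go to a fixed point [a0]; the enumeration may
    repeat. *)
Lemma countable_enum (T : Type) (x : set T) : countable x -> x !=set0 ->
  exists u : nat -> T, x = range u.
Proof.
move=> cx [a0 xa0]; have /pcard_injP[f fi] := cx.
have /choice[u uP] : forall n, exists a, x a /\ ((exists2 b, x b & f b = n) -> f a = n).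
  move=> n; have [[b xb fb]|nb] := pselect (exists2 b, x b & f b = n).
    by exists b.
  by exists a0; split=> // -[b xb fb]; case: nb; exists b.
exists u; apply/seteqP; split=> [a xa|_ [n _ <-]]; last by have [] := uP n.
exists (f a) => //; have [xu fu] := uP (f a).
by apply: fi; [exact: mem_set|exact: mem_set|apply: fu; exists a].
Qed.

Lemma denumerable_infinite (T : Type) (x : set T) :
  x #= [set: nat] -> infinite_set x.
Proof. by move=> /card_eqPle[_ ?]; apply/infiniteP. Qed.

Lemma denumerable_countable (T : Type) (x : set T) :
  x #= [set: nat] -> countable x.
Proof. by move=> /card_eqPle[]. Qed.

Lemma denumerable_enum (T : Type) (x : set T) : x #= [set: nat] ->
  exists u : nat -> T, x = range u.
Proof.
move=> xN; apply: countable_enum; first exact: denumerable_countable.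
by apply: infinite_setN0; exact: denumerable_infinite.
Qed.

(** * Closures and semistationary sets *)

Section Closure.
Context {d : Order.disp_t} {O : orderType d}.
Implicit Types (h : seq O -> nat -> O) (W x y : set O) (S : set (set O)).

(** The sequence [h e] stands for the countable set assigned to the tuple [e]; functions of this
    kind code the clubs of $[W]^\omega$. *)
Inductive cl h y : O -> Prop :=
| cl_base a : y a -> cl h y a
| cl_step e k : (forall a, a \in e -> cl h y a) -> cl h y (h e k).

Definition preserved h W : Prop :=
  forall (e : seq O) k, (forall a, a \in e -> W a) -> W (h e k).

Lemma cl_min h y W : y `<=` W -> preserved h W -> cl h y `<=` W.
Proof. by move=> yW hW a; elim=> [b /yW//|e k _ IH]; exact: hW. Qed.

Lemma cl_preserved h y : preserved h (cl h y).
Proof. by move=> e k ey; exact: cl_step. Qed.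

Lemma sub_cl h y : y `<=` cl h y.
Proof. by move=> a; exact: cl_base. Qed.

(* The values at stage m of the closure, listed by codes of applications of h
   to values of stage m - 1. *)
Fixpoint cl_enum h (u : nat -> O) (m c : nat) : O :=
  if m isn't m'.+1 then u c else
  match @unpickle (nat + seq nat * nat)%type c with
  | Some (inl j) => cl_enum h u m' j
  | Some (inr (l, k)) => h [seq cl_enum h u m' j | j <- l] k
  | None => u 0
  end.

(** The [inl] codes copy a value to the next stage, so the stages are cumulative. *)
Lemma cl_enumW h u m n c : (m <= n)%N ->
  exists c', cl_enum h u n c' = cl_enum h u m c.
Proof.
elim: n => [|n IH]; first by rewrite leqn0 => /eqP->; exists c.
rewrite leq_eqVlt => /orP[/eqP->|]; first by exists c.
rewrite ltnS => /IH[c' <-].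
by exists (pickle (inl c' : nat + seq nat * nat)); rewrite /= pickleK.
Qed.

(** The finitely many arguments of a step may appear at different stages; cumulativity brings them
    to a common one. *)
Lemma cl_enumP h u a : cl h (range u) a -> exists m c, cl_enum h u m c = a.
Proof.
elim=> [b [n _ <-]|e k _ IH]; first by exists 0, n.
have [m [l <-]] : exists m (l : seq nat), [seq cl_enum h u m j | j <- l] = e.
  elim: e IH => [|a' e IHe] IH; first by exists 0, [::].
  have [m [l el]] : exists m (l : seq nat), [seq cl_enum h u m j | j <- l] = e.
    by apply: IHe => a'' ae; apply: IH; rewrite inE ae orbT.
  have [m' [c' ec]] := IH a' (mem_head _ _).
  exists (maxn m m').
  have [c'' ec''] := cl_enumW h u c' (leq_maxr m m').
  have /choice[g gP] := fun c => cl_enumW h u c (leq_maxl m m').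
  exists (c'' :: map g l); rewrite /= ec'' ec -el -map_comp; congr cons.
  by apply: eq_map => j /=.
exists m.+1, (pickle (inr (l, k) : nat + seq nat * nat)).
by rewrite /= pickleK.
Qed.

Lemma cl_denumerable h y W : preserved h W ->
  ctbl_subsets W y -> ctbl_subsets W (cl h y).
Proof.
move=> hW [yW yN]; split; first exact: cl_min.
apply: eq_card_nat; last first.
  by apply: sub_infinite_set (@sub_cl h y) _; exact: denumerable_infinite.
have [u ->] := denumerable_enum yN.
apply: sub_countable (countable_range (fun c : nat * nat => cl_enum h u c.1 c.2)).
by apply: subset_card_le => a /cl_enumP[m [c <-]]; exists (m, c).
Qed.

(** The sets closed under [h] form a club. If a member [x] of it witnesses semistationarity through
    [y], then [cl h y] lies in [x], which has the same countable ordinals as [y]. *)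
Lemma semistationary_cl W S h : semistationary W S -> preserved h W ->
  exists y, [/\ S y, y `<=` W & cl h y `&` omega1 `<=` y].
Proof.
move=> SS hW.
have [|x [[xW hx] [_ [y [Sy yx yo]]]]] := SS [set x | ctbl_subsets W x /\ preserved h x].
  split.
  - by move=> x [].
  - move=> x xW; exists (cl h x); last exact: sub_cl.
    by split; [exact: cl_denumerable|exact: cl_preserved].
  - move=> X XC Xinc; split; last first.
      have inc m n : (m <= n)%N -> X m `<=` X n.
        exact: (homo_leq (r := fun A B : set O => A `<=` B)
          (@subset_refl O) (@subset_trans O) Xinc).
      move=> e k ey.
      (* A finite tuple from the union already lies in one member of the chain, and that member is
         closed under [h]. *)
      have [n en] : exists n, forall a, a \in e -> X n a.
        elim: e ey => [|a e IH] ey; first by exists 0.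
        have [n en] : exists n, forall a, a \in e -> X n a.
          by apply: IH => b be; apply: ey; rewrite inE be orbT.
        have [m _ am] := ey a (mem_head _ _).
        exists (maxn n m) => b; rewrite inE => /orP[/eqP->|/en].
          exact: inc (leq_maxr _ _) _ am.
        exact: inc (leq_maxl _ _) _.
      by exists n => //; have [_] := XC n; apply.
    split; first by move=> a [n _]; have [[+ _] _] := XC n; apply.
    apply: eq_card_nat.
      by apply: bigcup_countable => // n _; have [[_ /denumerable_countable]] := XC n.
    have [[_ /denumerable_infinite X0] _] := XC 0.
    by apply: sub_infinite_set X0 => a ?; exists 0.
exists y; split=> //.
  by apply: subset_trans yx _; case: xW.
move=> a [ca oa]; have : (x `&` omega1) a by split=> //; apply: cl_min hx _ ca.
by rewrite -yo => -[].
Qed.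

(** Given a club [C], members [phi e] of [C] are attached to finite tuples, and [h e] enumerates
    [phi e]. A denumerable set closed under this [h] is the increasing union of the [phi e] along an
    enumeration of its points, so it is in [C]. The set [x0] provides a first member of [C]. *)
Lemma cl_semistationary W S x0 : ctbl_subsets W x0 -> S `<=` ctbl_subsets W ->
  (forall h, preserved h W -> exists2 y, S y & cl h y `&` omega1 `<=` y) ->
  semistationary W S.
Proof.
move=> Wx0 SW H C [CW Cu Cc].
have [c0 Cc0 _] := Cu _ Wx0.
have /choice[f fP] : forall ax : O * set O, exists y,
    C ax.2 -> W ax.1 -> [/\ C y, ax.2 `<=` y & y ax.1].
  move=> [a x] /=; have [[Cx Wa]|nCx] := pselect (C x /\ W a); last first.
    by exists set0 => ? ?; case: nCx.
  have [xW xN] := CW _ Cx.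
  have [|y Cy xy] := Cu (x `|` [set a]).
    split; first by move=> b [/xW//|->].
    apply: eq_card_nat.
      rewrite -bigcup2E; apply: bigcup_countable => // -[|[|n]] _ //=.
      exact: denumerable_countable.
    by apply: sub_infinite_set (denumerable_infinite xN) => b; left.
  by exists y => _ _; split=> // [b xb|]; apply: xy; [left|right].
(* [phi (a :: e)] contains both [phi e] and [a]. New points enter at the head, hence the reversed
   lists below. *)
pose phi := foldr (fun a x => f (a, x)) c0.
have phiC e : (forall a, a \in e -> W a) -> C (phi e).
  elim: e => // a e IH ey /=; have [| |//] := fP (a, phi e).
    by apply: IH => b be; apply: ey; rewrite inE be orbT.
  by apply: ey; rewrite mem_head.
have /choice[h hP] : forall e, exists u : nat -> O,
    (forall a, a \in e -> W a) -> phi e = range u.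
  move=> e; have [/phiC/CW[_ /denumerable_enum[u ue]]|ne] :=
    pselect (forall a, a \in e -> W a); first by exists u.
  by have [u _] := denumerable_enum (CW _ Cc0).2; exists u => ?; case: ne.
have hW : preserved h W.
  move=> e k eW; have [+ _] := CW _ (phiC _ eW); apply; rewrite hP //; by exists k.
have [y Sy yc] := H h hW.
have yx := @sub_cl h y.
exists (cl h y); split; last first.
  split; first by apply: cl_denumerable => //; exact: SW.
  exists y; split=> //; apply/seteqP; split=> a [ya oa]; split=> //; first exact: yx.
  by apply: yc.
have [ySW yN] : ctbl_subsets W (cl h y) by apply: cl_denumerable => //; exact: SW.
have [w we] := denumerable_enum yN.
have wcl n a : a \in rev (mkseq w n) -> cl h y a.
  by rewrite mem_rev => /mapP[i _ ->]; rewrite we; exists i.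
have wW n a : a \in rev (mkseq w n) -> W a by move=> /wcl/ySW.
have phiS n : phi (rev (mkseq w n.+1)) = f (w n, phi (rev (mkseq w n))).
  by rewrite mkseqS rev_rcons.
have WP n : W (w n) by apply: ySW; rewrite we; exists n.
have -> : cl h y = \bigcup_n phi (rev (mkseq w n)).
  apply/seteqP; split=> a.
    rewrite we => -[n _ <-]; exists n.+1 => //; rewrite phiS.
    by have [] := fP (w n, phi (rev (mkseq w n))) (phiC _ (wW n)) (WP n).
  move=> [n _]; rewrite hP => [[k _ <-]|]; last exact: wW.
  by apply: cl_step => b; exact: wcl.
apply: Cc => n; first by apply: phiC; exact: wW.
rewrite phiS.
by have [] := fP (w n, phi (rev (mkseq w n))) (phiC _ (wW n)) (WP n).
Qed.

End Closure.

(** * Well-orders and the set of countable ordinals *)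

Section WellOrder.
Context {d : Order.disp_t} {O : orderType d}.

Lemma wo_min (A : set O) : well_ordered O -> A !=set0 ->
  exists2 m, A m & forall b, A b -> m <= b.
Proof.
move=> wo [a Aa]; have [|m [[mA mm] _]] := wo (mem A).
  by exists a; exact: mem_set.
by exists m => [|b Ab]; [exact: set_mem|apply: mm; exact: mem_set].
Qed.

Lemma sub_below (a b : O) : a <= b -> below a `<=` below b.
Proof. by move=> ab c /= ca; exact: lt_le_trans ab. Qed.

Lemma omega1_down (a b : O) : omega1 a -> b <= a -> omega1 b.
Proof. by move=> oa ba; apply: sub_countable oa; exact/subset_card_le/sub_below. Qed.

(** All predecessors of the least ordinal outside [omega1] are in [omega1]; if [omega1] were
    countable, so would be that ordinal. *)
Lemma omega1_uncountable (a : O) : well_ordered O -> ~ omega1 a ->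
  ~ countable (omega1 : set O).
Proof.
move=> wo na co.
have [|m nm mm] := wo_min (A := ~` omega1) wo; first by exists a.
apply: nm; apply: sub_countable co; apply: subset_card_le => b bm.
by apply: contrapT => /mm; rewrite leNgt bm.
Qed.

End WellOrder.

(** * Forcing with a preorder *)

(** Position [m] is where the value of rank [n], counted from 0 in order of first appearance, occurs
    first. This yields surjectivity when repetitions are removed from an enumeration. *)
Lemma nth_undup_rank (T : eqType) (v0 : T) (vs : seq T) n :
  (n < size (undup vs))%N -> exists m, [/\ (m < size vs)%N,
    nth v0 vs m \notin take m vs & size (undup (take m vs)) = n].
Proof.
have szr (s : seq T) v : size (undup (rcons s v)) = (size (undup s) + (v \notin s))%N.
  have -> : size (undup (rcons s v)) = size (undup (v :: s)).
    apply/perm_size; apply: uniq_perm; rewrite ?undup_uniq // => x.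
    by rewrite !mem_undup mem_rcons.
  by rewrite /=; case: (v \in s) => /=; rewrite ?addn0 ?addn1.
elim/last_ind: vs => // vs v IH.
have [lt|ge] := ltnP n (size (undup vs)).
  have [m [mv nm sm]] := IH lt; exists m.
  have tk : take m (rcons vs v) = take m vs by rewrite -cats1 take_cat mv.
  by rewrite size_rcons ltnS ltnW // nth_rcons mv tk.
rewrite szr; have [vin|vnin] := boolP (v \in vs); first by rewrite addn0 ltnNge ge.
rewrite addn1 ltnS => le; exists (size vs).
rewrite size_rcons ltnSn nth_rcons ltnn eqxx -cats1 take_size_cat //.
by split=> //; apply/eqP; rewrite eqn_leq le ge.
Qed.

Section ForcingBasics.
Context {P : Type}.
Variable le : P -> P -> Prop.
Hypothesis le_refl : forall p, le p p.
Hypothesis le_trans : forall q p r, le p q -> le q r -> le p r.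
Implicit Types (p q r s : P) (F G : set P).

(** The two properties of the set of conditions that force a sentence: it passes to stronger
    conditions, and it contains every condition below which it is dense. *)
Definition stable F : Prop := (forall p q, F p -> le q p -> F q) /\
  (forall p, (forall q, le q p -> exists2 r, le r q & F r) -> F p).

Lemma stable_fground (A : Prop) : stable (fground A).
Proof. by split=> [//|p /(_ p (le_refl p))[]]. Qed.

Lemma stable_fand F G : stable F -> stable G -> stable (fand F G).
Proof.
move=> [F1 F2] [G1 G2]; split=> [p q [Fp Gp] qp|p H].
  by split; [exact: F1 qp|exact: G1 qp].
by split; [apply: F2|apply: G2] => q /H[r rq []]; exists r.
Qed.

Lemma stable_fimp F G : (forall p q, F p -> le q p -> F q) -> stable G ->
  stable (fimp le F G).
Proof.
move=> F1 [G1 G2]; split=> [p q H qp r rq Fr|p H q qp Fq].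
  by apply: H => //; exact: le_trans qp.
apply: G2 => r rq; have [s sr Hs] := H r (le_trans rq qp).
by exists s => //; apply: Hs => //; apply: F1 Fq _; exact: le_trans rq.
Qed.

Lemma stable_fiff F G : stable F -> stable G -> stable (fiff le F G).
Proof.
by move=> sF sG; apply: stable_fand; apply: stable_fimp => //; case: sF; case: sG.
Qed.

Lemma stable_fall X (H : X -> fprop) : (forall x, stable (H x)) -> stable (fall H).
Proof.
move=> sH; split=> [p q Hp qp x|p Hp x]; first by have [+ _] := sH x; apply; last exact: qp.
by have [_] := sH x; apply=> q /Hp[r rq Hr]; exists r.
Qed.

Lemma stable_fex X (H : X -> fprop) : stable (fex le H).
Proof.
split=> [p q Hp qp r rq|p Hp q qp]; first by apply: Hp; exact: le_trans qp.
have [r rq Hr] := Hp q qp; have [s sr Hs] := Hr r (le_refl r).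
by exists s => //; exact: le_trans rq.
Qed.

Lemma stable_fmem_for X (eqX : X -> X -> fprop) x (A : name X) :
  stable (fmem_for le eqX x A).
Proof.
split=> [p q Hp qp r rq|p Hp q qp]; first by apply: Hp; exact: le_trans qp.
have [r rq Hr] := Hp q qp; have [s sr Hs] := Hr r (le_refl r).
by exists s => //; exact: le_trans rq.
Qed.

Lemma stable_fmem X (x : X) (A : name X) : stable (fmem le x A).
Proof. exact: stable_fmem_for. Qed.

Lemma fmem_mono X (x : X) (A : name X) p q : fmem le x A p -> le q p -> fmem le x A q.
Proof. by have [+ _] := stable_fmem x A; apply. Qed.

Lemma fmem_intro X (x : X) (A : name X) p s : A (s, x) -> le p s -> fmem le x A p.
Proof.
move=> As ps q qp; exists q => //; exists s, x; split=> //; exact: le_trans ps.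
Qed.

Lemma fmem_elim X (x : X) (A : name X) p q : fmem le x A p -> le q p ->
  exists2 r, le r q & exists2 s, A (s, x) & le r s.
Proof.
move=> H /H[r rq [s [y [As rs e]]]]; exists r => //; exists s => //.
by rewrite e.
Qed.

Lemma fmem_check X (x : X) (A : set X) p : fmem le x (check A) p <-> A x.
Proof.
split=> [H|Ax]; last exact: (@fmem_intro _ _ _ p p).
by have [r _ [s]] := fmem_elim H (le_refl p).
Qed.

(** The canonical name of the set that the formula [F] defines in the extension. *)
Definition name_of X (F : X -> set P) : @name P X := [set sx | F sx.2 sx.1].

Lemma fmem_name_of X (F : X -> fprop) x p : stable (F x) ->
  fmem le x (name_of F) p <-> F x p.
Proof.
move=> [F1 F2]; split=> [H|Fp]; last exact: (@fmem_intro _ _ _ p p).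
by apply: F2 => q qp; have [r rq [s Fs rs]] := fmem_elim H qp; exists r => //; apply: F1 rs.
Qed.

Lemma feq_refl X (A : name X) p : feq le A A p.
Proof. by split. Qed.

Lemma feq_mem X (A B : name X) p q x : feq le A B p -> le q p ->
  fmem le x A q <-> fmem le x B q.
Proof. by move=> /(_ x)[AB BA] qp; split; [exact: AB|exact: BA]. Qed.

Lemma feq_mono X (A B : name X) p q : feq le A B p -> le q p -> feq le A B q.
Proof.
have [+ _] : stable (feq le A B); last by apply.
by apply: stable_fall => x; apply: stable_fiff; exact: stable_fmem.
Qed.

Lemma feq_sym X (A B : name X) p : feq le A B p -> feq le B A p.
Proof. by move=> H x; have [? ?] := H x; split. Qed.

Lemma stable_fsub X (A B : name X) : stable (fsub le A B).
Proof.
apply: stable_fall => x; apply: stable_fimp; last exact: stable_fmem.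
by move=> p q; exact: fmem_mono.
Qed.

Lemma fsub_trans X (A B C : name X) p : fsub le A B p -> fsub le B C p -> fsub le A C p.
Proof. by move=> AB BC x q qp xA; apply: BC => //; exact: AB. Qed.

(** Members of a named family are themselves names, known only up to forced equality; a formula can
    define a family only if it is invariant under that equality. *)
Definition respects X (F : name X -> fprop) : Prop :=
  forall x y r, feq le x y r -> F x r -> F y r.

Lemma fmem2_respects X (C : name (name X)) : respects (fun x => fmem2 le x C).
Proof.
move=> x y r xy xC q qr; have [s sq [t [z [Ctz st xz]]]] := xC q qr.
exists s => //; exists t, z; split=> // a.
have xy' : feq le x y s by apply: feq_mono xy _; exact: le_trans qr.
split=> u us H.
  by apply/(feq_mem _ xz us)/(feq_mem _ xy' us).
by apply/(feq_mem _ xy' us)/(feq_mem _ xz us).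
Qed.

Lemma fmem2_name_of X (F : name X -> fprop) x p : (forall y, stable (F y)) ->
  respects F -> fmem2 le x (name_of F) p <-> F x p.
Proof.
move=> sF rF; split=> [H|Fp].
  have [F1 F2] := sF x; apply: F2 => q qp.
  have [r rq [s [y [Fs rs xy]]]] := H q qp; exists r => //.
  by apply: rF (feq_sym xy) _; have [+ _] := sF y; apply; first exact: Fs.
move=> q qp; exists q => //; exists p, x; split=> //; exact: feq_refl.
Qed.

Lemma fmem2_check2 X (S : set (set X)) y p : S y -> fmem2 le (check y) (check2 S) p.
Proof.
move=> Sy q _; exists q => //; exists q, (check y); split=> //; last exact: feq_refl.
by exists y.
Qed.

Lemma fmem2_check2_elim X (S : set (set X)) (y : name X) p :
  fmem2 le y (check2 S) p ->
  exists2 r, le r p & exists2 y0, S y0 & feq le y (check y0) r.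
Proof.
move=> /(_ p (le_refl p))[r rp [s [z [[A SA /= ->] _ yz]]]].
by exists r => //; exists A.
Qed.

(* Mixing along a maximal antichain of conditions that decide a witness. *)
Lemma fex_full X (F : name X -> fprop) p : (forall x, stable (F x)) ->
  respects F -> fex le F p -> exists x, F x p.
Proof.
move=> sF rF Fp.
pose D r := le r p /\ exists x, F x r.
have /choice[w wP] : forall r, exists x, D r -> F x r.
  move=> r; have [[rp [x Fx]]|nD] := pselect (D r); first by exists x.
  by exists set0.
pose Q (A : set P) := A `<=` D /\
  forall r s t, A r -> A s -> le t r -> le t s -> r = s.
have [G GQ Gtot|A [[AD Aa] Amax]] := @Zorn_bigcup _ Q.
  split=> [r [A /GQ[AD _] /AD//]|r s t [A GA Ar] [B GB Bs]].
  have [/(_ _ Ar) Br|/(_ _ Bs) As] := Gtot _ _ GA GB.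
    by have [_ +] := GQ _ GB; apply.
  by have [_ +] := GQ _ GA; apply.
(* Below [r] in the antichain [A], the mixed name [x] has the same members as the chosen witness
   [w r]. *)
pose x : name X := [set sa | exists2 r, A r & le sa.1 r /\ fmem le sa.2 (w r) sa.1].
have wx r : A r -> feq le (w r) x r.
  move=> Ar a; split=> q qr H.
    by apply: (@fmem_intro _ _ _ q q) => //=; exists r.
  have [_] := stable_fmem a (w r); apply=> s sq.
  have [t ts [u [r0 Ar0 /= [ur0 au]] tu]] := fmem_elim H sq.
  exists t => //; have -> : r = r0.
    apply: (Aa r r0 t) => //; last exact: le_trans tu ur0.
    exact: le_trans (le_trans ts sq) qr.
  exact: fmem_mono tu.
exists x; have [F1 F2] := sF x; apply: F2 => q qp.
have [r rq [y Fy]] := Fp q qp.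
have Dr : D r by split; [exact: le_trans qp|exists y].
(* If [r] were incompatible with every member of [A], it could be added to [A], against
   maximality. *)
have [t tr [s As ts]] : exists2 t, le t r & exists2 s, A s & le t s.
  apply: contrapT => H; apply: (Amax (A `|` [set r])).
    split=> [s|/(_ r)]; first by left.
    by move=> Ar; apply: H; exists r => //; exists r => //; apply: Ar; right.
  split=> [s [/AD//|->//]|a b t [Aa'|->] [Ab|->] ta tb] //.
  - exact: Aa ta tb.
  - by case: H; exists t => //; exists a.
  - by case: H; exists t => //; exists b.
exists t; first exact: le_trans rq.
apply: F1 ts; apply: rF (wx s As) _; apply: wP; exact: AD.
Qed.

(** * Enumerations and denumerable sets in the extension *)

Section Denumerable.
Context {T : eqType}.
Variable v0 : T.
Implicit Types (x z : @name P T) (E : nat -> T -> set P).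

(* E c v is the statement that v is the c-th term of an enumeration of z in
   the extension. *)
Record forced_enum p E z : Prop := ForcedEnum {
  fenum_mono : forall c v r s, E c v r -> le s r -> E c v s;
  fenum_fun : forall c v v' r, le r p -> E c v r -> E c v' r -> v = v';
  fenum_tot : forall c r, le r p -> exists2 s, le s r & exists v, E c v s;
  fenum_sound : forall c v r, le r p -> E c v r -> fmem le v z r;
  fenum_onto : forall a r, le r p -> fmem le a z r ->
    exists2 s, le s r & exists c, E c a s }.

Lemma forced_enumW p q E z : forced_enum p E z -> le q p -> forced_enum q E z.
Proof.
case=> h1 h2 h3 h4 h5 qp; split=> //.
- by move=> c v v' r /le_trans /(_ qp); exact: h2.
- by move=> c r /le_trans /(_ qp); exact: h3.
- by move=> c v r /le_trans /(_ qp); exact: h4.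
- by move=> c r /le_trans /(_ qp); exact: h5.
Qed.

Lemma fenum_decide p E z n r : forced_enum p E z -> le r p ->
  exists2 s, le s r & exists2 vs, size vs = n &
    forall i, (i < n)%N -> E i (nth v0 vs i) s.
Proof.
move=> [Emono _ Etot _ _] rp; elim: n => [|n [s sr [vs sz vsE]]].
  by exists r => //; exists [::].
have [t ts [v Ev]] := Etot n s (le_trans sr rp).
exists t; first exact: le_trans sr.
exists (rcons vs v); first by rewrite size_rcons sz.
move=> i; rewrite ltnS leq_eqVlt => /orP[/eqP->|lt].
  by rewrite nth_rcons sz ltnn eqxx.
by rewrite nth_rcons sz lt; apply: Emono ts; exact: vsE.
Qed.

(** Infinity is expressed through finite lists of distinct elements, which single conditions can
    decide. *)
Definition forced_infinite p z : Prop := forall n r, le r p ->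
  exists2 s, le s r & exists vs, [/\ uniq vs, size vs = n &
    forall v, v \in vs -> fmem le v z s].

(* a is sent to the number of distinct terms that precede its first
   occurrence. *)
Lemma fenum_denumerable p E z : forced_enum p E z -> forced_infinite p z ->
  fdenumerable le z p.
Proof.
move=> HE Hinf; have [Emono Efun Etot Esound Eonto] := HE.
(* [m] is the first position of the element, and all terms up to it are decided. *)
pose G (an : T * nat) r := exists m vs, [/\ size vs = m,
  forall i, (i < m)%N -> E i (nth v0 vs i) r, E m an.1 r, an.1 \notin vs &
  size (undup vs) = an.2].
have Gmono an r s : G an r -> le s r -> G an s.
  move=> [m [vs [sz vsE Em nin u]]] sr; exists m, vs; split=> //.
    by move=> i im; apply: Emono sr; exact: vsE.
  exact: Emono sr.
pose R : name (T * nat) := name_of G.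
have RP an r : fmem le an R r -> forall q, le q r -> exists2 s, le s q & G an s.
  move=> H q qr; have [s sq [t Gt st]] := fmem_elim H qr; exists s => //.
  exact: Gmono st.
have PR an r : G an r -> fmem le an R r by move=> Gr; exact: (fmem_intro Gr (le_refl r)).
(* The first positions of [a] and [b] are compared. Equal positions mean equal elements; a later
   position for [b] means a larger index, because [a] is then counted; an earlier one contradicts
   the assumption on the indices. *)
have Gsame a b n m vs r : le r p -> size vs = m ->
    (forall i, (i < m)%N -> E i (nth v0 vs i) r) -> E m a r -> a \notin vs ->
    G (b, n) r -> (size (undup vs) <= n)%N ->
    a = b /\ size (undup vs) = n \/ ((size (undup vs)) < n)%N /\ a <> b.
  move=> rp sz vsE Ea nin [m' [vs' /= [sz' vsE' Eb nin' sn]]] leu.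
  have common i : (i < m)%N -> (i < m')%N -> nth v0 vs i = nth v0 vs' i.
    by move=> im im'; apply: (Efun i _ _ r) => //; [exact: vsE|exact: vsE'].
  have [lt|gt|e] := ltngtP m m'.
  - right; have av' : nth v0 vs' m = a by apply: (Efun m _ _ r) => //; exact: vsE'.
    have ain : a \in vs' by rewrite -av' mem_nth // sz'.
    split; last by move=> e; move: nin'; rewrite -e ain.
    rewrite -sn; apply: (@leq_trans (size (a :: undup vs))) => //.
    apply: uniq_leq_size; first by rewrite /= undup_uniq mem_undup nin.
    move=> w; rewrite inE => /orP[/eqP->|]; first by rewrite mem_undup.
    rewrite !mem_undup => /(nthP v0)[i]; rewrite sz => im <-.
    by rewrite (common i im (ltn_trans im lt)) mem_nth // sz' (ltn_trans im lt).
  - have bin : b \in vs.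
      have <- : nth v0 vs m' = b by apply: (Efun m' _ _ r) => //; exact: vsE.
      by rewrite mem_nth // sz.
    exfalso; move: leu; rewrite -sn leqNgt => /negP; apply.
    apply: (@leq_trans (size (b :: undup vs'))) => //.
    apply: uniq_leq_size; first by rewrite /= undup_uniq mem_undup nin'.
    move=> w; rewrite inE => /orP[/eqP->|]; first by rewrite mem_undup.
    rewrite !mem_undup => /(nthP v0)[i]; rewrite sz' => im <-.
    by rewrite -(common i (ltn_trans im gt) im) mem_nth // sz (ltn_trans im gt).
  - move: sz' vsE' Eb common; rewrite -e => sz' vsE' Eb common.
    left; split; first by apply: (Efun m _ _ r).
    have -> : vs = vs'.
      apply: (@eq_from_nth _ v0); first by rewrite sz sz'.
      by move=> i; rewrite sz => im; apply: common.
    by [].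
have Gfun a n n' r : le r p -> G (a, n) r -> G (a, n') r -> n = n'.
  move=> rp H H'.
  wlog nn : n n' H H' / (n <= n')%N.
    by move=> W; have [nn|/ltnW nn] := leqP n n'; [exact: W|symmetry; exact: W].
  have [m [vs /= [sz vsE Ea nin sn]]] := H.
  have := @Gsame a a n' m vs r rp sz vsE Ea nin H'; rewrite sn => /(_ nn).
  by case=> [[]|[]].
have Ginj a b n r : le r p -> G (a, n) r -> G (b, n) r -> a = b.
  move=> rp [m [vs /= [sz vsE Ea nin sn]]] H'.
  have := @Gsame a b n m vs r rp sz vsE Ea nin H'; rewrite sn => /(_ (leqnn _)).
  by case=> [[]|[+ _]]; rewrite ?ltnn.
move=> p1 p1p; exists p1 => //; exists R; split; last first.
  move=> n q qp1; have qp := le_trans qp1 p1p.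
  (* [n.+1] distinct elements have codes below some [N], so the first [N] terms contain a value of
     rank [n]. *)
  have [s sq [vs [uvs szvs vsz]]] := Hinf n.+1 q qp.
  have [t ts [N codes]] : exists2 t, le t s & exists N, forall v, v \in vs ->
      exists2 c, (c < N)%N & E c v t.
    have sp := le_trans sq qp.
    elim: vs {uvs szvs} vsz => [|v vs IH] vsz; first by exists s => //; exists 0.
    have [t ts [N codes]] : exists2 t, le t s & exists N, forall v, v \in vs ->
        exists2 c, (c < N)%N & E c v t.
      by apply: IH => w wvs; apply: vsz; rewrite inE wvs orbT.
    have [|u ut [c Ec]] := Eonto v t (le_trans ts sp).
      by apply: fmem_mono ts; apply: vsz; rewrite mem_head.
    exists u; first exact: le_trans ts.
    exists (maxn N c.+1) => w; rewrite inE => /orP[/eqP->|/codes[c' c'N Ec']].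
      by exists c => //; rewrite leq_max leqnn orbT.
    by exists c'; [rewrite leq_max c'N|exact: Emono ut].
  have tp : le t p := le_trans ts (le_trans sq qp).
  have [u ut [ws szws wsE]] := fenum_decide N HE tp.
  have up := le_trans ut tp.
  have [|m [mN nin rk]] := @nth_undup_rank _ v0 ws n.
    rewrite -szvs; apply: uniq_leq_size => // w /codes[c cN Ec].
    rewrite mem_undup.
    have -> : w = nth v0 ws c.
      by apply: (Efun c _ _ u) => //; [exact: Emono ut|exact: wsE].
    by rewrite mem_nth // szws.
  exists u; first by apply: le_trans ut _; exact: le_trans sq.
  exists (nth v0 ws m); apply: PR; exists m, (take m ws); split=> //.
  - by rewrite size_takel // ltnW.
  - move=> i im; rewrite nth_take //; apply: wsE; apply: ltn_trans im _.
    by rewrite -szws.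
  - by apply: wsE; rewrite -szws.
split.
  move=> a; split=> q qp1 H; have qp := le_trans qp1 p1p.
    move=> r rq; have rp := le_trans rq qp.
    have [s sr [c Ec]] := Eonto a r rp (fmem_mono H rq).
    have sp := le_trans sr rp.
    have [t ts [vs szvs vsE]] := fenum_decide c.+1 HE sp.
    have tp := le_trans ts sp.
    have ain : a \in vs.
      have <- : nth v0 vs c = a.
        by apply: (Efun c _ _ t) => //; [exact: vsE|exact: Emono ts].
      by rewrite mem_nth // szvs.
    exists t; first exact: le_trans sr.
    exists (size (undup (take (index a vs) vs))); apply: PR.
    have ilt : (index a vs < c.+1)%N by rewrite -szvs index_mem.
    exists (index a vs), (take (index a vs) vs); split=> //=.
    - by rewrite size_takel // szvs ltnW.
    - by move=> i im; rewrite nth_take //; apply: vsE; exact: ltn_trans ilt.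
    - by rewrite -{2}(nth_index v0 ain); exact: vsE.
    - apply/negP => /(nthP v0)[i]; rewrite size_takel ?szvs ?(ltnW ilt) // => ii.
      rewrite nth_take // => e; have := before_find v0 ii.
      by rewrite /= e eqxx.
  have [_] := stable_fmem a z; apply=> r rq.
  have [s sr [n Hn]] := H r rq.
  have [t ts [m [vs [_ _ Em _ _]]]] := RP _ _ Hn s (le_refl s).
  have tr := le_trans ts sr.
  exists t => //; apply: Esound Em; exact: le_trans tr (le_trans rq qp).
split.
  move=> a n m q qp1 [H1 H2]; have qp := le_trans qp1 p1p.
  have [s sq G1] := RP _ _ H1 q (le_refl q).
  have [t ts G2] := RP _ _ (fmem_mono H2 sq) s (le_refl s).
  apply: (Gfun a n m t) => //; last exact: Gmono ts.
  exact: le_trans ts (le_trans sq qp).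
move=> a b n q qp1 [H1 H2]; have qp := le_trans qp1 p1p.
have [s sq G1] := RP _ _ H1 q (le_refl q).
have [t ts G2] := RP _ _ (fmem_mono H2 sq) s (le_refl s).
apply: (Ginj a b n t) => //; last exact: Gmono ts.
exact: le_trans ts (le_trans sq qp).
Qed.

Definition fbijection x (R : name (T * nat)) : fprop :=
  fand (finjection le x R) (fall (fun n => fex le (fun a => fmem le (a, n) R))).

Lemma fbijection_enum x R p : fbijection x R p ->
  forced_enum p (fun c v => fmem le (v, c) R) x.
Proof.
move=> [[dom [fn inj]] surj]; split.
- by move=> c v r s; exact: fmem_mono.
- by move=> c v v' r rp H1 H2; apply: (inj v v' c r rp).
- by move=> c r rp; have [s sr [a aR]] := surj c r rp; exists s => //; exists a.
- move=> c v r rp H; have [_ +] := dom v; apply => // q qr.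
  by exists q => //; exists c; exact: fmem_mono qr.
- move=> a r rp H; have [+ _] := dom a => /(_ r rp H r (le_refl r))[s sr [n Hn]].
  by exists s => //; exists n.
Qed.

Lemma fbijection_infinite x R p : fbijection x R p -> forced_infinite p x.
Proof.
move=> H n r rp; have HE := fbijection_enum H.
have [s sr [vs szvs vsE]] := fenum_decide n HE rp; have sp := le_trans sr rp.
exists s => //; exists vs; split=> //.
  apply/(uniqP v0) => i j; rewrite !inE szvs => ilt jlt e.
  have [[_ [+ _]] _] := H => /(_ (nth v0 vs i) i j s sp); apply.
  by split; [exact: vsE|rewrite e; exact: vsE].
by move=> v /(nthP v0)[i]; rewrite szvs => ilt <-; apply: (fenum_sound HE sp (vsE _ ilt)).
Qed.

(** The set [z] is infinite because of its denumerable subset [x]; the enumeration [E] may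
    repeat. *)
Lemma fdenumerable_enum p E x z : forced_enum p E z -> fdenumerable le x p ->
  fsub le x z p -> fdenumerable le z p.
Proof.
move=> HE Hx xz; have [_] := stable_fex (fbijection z); apply=> q qp.
have [r rq [R HR]] := Hx q qp; have rp := le_trans rq qp; exists r => //.
apply: fenum_denumerable (forced_enumW HE rp) _ => n s sr.
have [t ts [vs [uv szv vsx]]] := fbijection_infinite HR n sr.
exists t => //; exists vs; split=> // v /vsx.
by apply: xz; exact: le_trans ts (le_trans sr rp).
Qed.

Lemma stable_fbijection x R : stable (fbijection x R).
Proof.
apply: stable_fand; last by apply: stable_fall => n; exact: stable_fex.
have sf := @stable_fmem (T * nat)%type.
apply: stable_fand.
  apply: stable_fall => a; apply: stable_fiff => //; first exact: stable_fmem.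
  exact: stable_fex.
apply: stable_fand; do 3!apply: stable_fall => ?;
  apply: stable_fimp => //; try exact: stable_fground;
  by move=> ? ? [H1 H2] H; split; exact: fmem_mono H.
Qed.

Lemma fbijection_respects x : respects (fbijection x).
Proof.
move=> R R' r RR [[dom [fn inj]] surj]; split; last first.
  move=> n q qr; have [s sq [a aR]] := surj n q qr; exists s => //; exists a.
  by apply/(feq_mem _ RR) => //; exact: le_trans qr.
split; last split.
- move=> a; have [d1 d2] := dom a; split=> q qr H.
    move=> s sq; have [t ts [n tn]] := d1 q qr H s sq; exists t => //; exists n.
    by apply/(feq_mem _ RR) => //; exact: le_trans ts (le_trans sq qr).
  apply: d2 => // s sq; have [t ts [n tn]] := H s sq; exists t => //; exists n.
  by apply/(feq_mem _ RR) => //; exact: le_trans ts (le_trans sq qr).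
- move=> a n m q qr [/(feq_mem _ RR qr) H1 /(feq_mem _ RR qr) H2].
  exact: (fn a n m q qr).
- move=> a b n q qr [/(feq_mem _ RR qr) H1 /(feq_mem _ RR qr) H2].
  exact: (inj a b n q qr).
Qed.

(** By mixing, one name of a bijection works at [p] itself and not just densely below it. *)
Lemma fdenumerable_full x p : fdenumerable le x p -> exists R, fbijection x R p.
Proof.
move=> H; apply: (fex_full _ _ H) => [R|].
  exact: stable_fbijection.
exact: fbijection_respects.
Qed.

Lemma stable_fdenumerable x : stable (fdenumerable le x).
Proof. exact: stable_fex. Qed.

Lemma fdenumerable_respects : respects (fdenumerable le (X := T)).
Proof.
move=> x y r xy H; move=> q qr; have [s sq [R [[dom fi] surj]]] := H q qr.
exists s => //; exists R; split=> //; split=> // a; have [d1 d2] := dom a.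
split=> t ts H'.
  by apply: d1 => //; apply/(feq_mem _ xy) => //; exact: le_trans ts (le_trans sq qr).
by apply/(feq_mem _ xy); [exact: le_trans ts (le_trans sq qr)|exact: d2].
Qed.

Lemma finjection_check (A : set T) (f : T -> nat) p : {in A &, injective f} ->
  finjection le (check A) (check [set an | A an.1 /\ f an.1 = an.2]) p.
Proof.
move=> fi; split; last split.
- move=> a; split=> r rp.
    by move=> /fmem_check Aa s sr; exists s => //; exists (f a); exact/fmem_check.
  by move=> /(_ r (le_refl r))[s sr [n /fmem_check[Aa _]]]; exact/fmem_check.
- by move=> a n m r rp [/fmem_check[_ /= <-] /fmem_check[_ /= <-]].
- move=> a b n r rp [/fmem_check[Aa /= e] /fmem_check[Ab /= e']].
  by apply: fi; rewrite ?in_setE // e e'.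
Qed.

Lemma fcountable_check (A : set T) p : countable A -> fcountable le (check A) p.
Proof.
by move=> /pcard_injP[f fi] q qp; exists q => //; eexists; exact: finjection_check fi.
Qed.

Lemma fdenumerable_check (A : set T) p :
  A #= [set: nat] -> fdenumerable le (check A) p.
Proof.
move=> /card_set_bijP[f [_ fi fs]] q qp; exists q => //.
eexists; split; first exact: finjection_check fi.
move=> n r rq; exists r => //; have [a Aa fa] := fs n I; exists a.
exact/fmem_check.
Qed.

End Denumerable.

Lemma fclubW {d : Order.disp_t} {O : orderType d} (W : name O) C p q :
  fclub le W C p -> le q p -> fclub le W C q.
Proof.
move=> [c1 [c2 c3]] qp; split; last split.
- by move=> x r rq; apply: c1; exact: le_trans rq qp.
- by move=> x r rq; apply: c2; exact: le_trans rq qp.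
- by move=> X r rq; apply: c3; exact: le_trans rq qp.
Qed.

Lemma fsub_respects X (x : name X) : respects (fsub le x).
Proof.
move=> y z r yz xy a q qr xa; apply/(feq_mem _ (feq_sym yz)) => //; exact: xy.
Qed.

Section Adjoin.
Context {T : eqType}.

Definition adjoin (x : @name P T) (a : T) : @name P T := [set sb | x sb \/ sb.2 = a].

Lemma fmem_adjoin x a b p : fmem le b (adjoin x a) p ->
  b = a \/ exists2 r, le r p & fmem le b x r.
Proof.
move=> H; have [r rp [s [xs|/= ->] rs]] := fmem_elim H (le_refl p); last by left.
by right; exists r => //; exact: fmem_intro rs.
Qed.

Lemma fsub_adjoin x a p : fsub le x (adjoin x a) p.
Proof.
move=> b q qp xb r rq; have [s sr [t xt st]] := fmem_elim xb rq.
by exists s => //; exists t, b; split=> //; left.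
Qed.

Lemma adjoin_mem x a p : fmem le a (adjoin x a) p.
Proof. by apply: (fmem_intro (s := p)) => //; right. Qed.

Lemma fdenumerable_adjoin x a p : fdenumerable le x p -> fdenumerable le (adjoin x a) p.
Proof.
move=> dx; have [R RP] := fdenumerable_full dx.
have [Em Ef Et Es Eo] := fbijection_enum RP.
(* The new point [a] takes index 0, and the terms of [x] are shifted by one. *)
apply: (fdenumerable_enum a (E := fun c v r =>
  if c is c'.+1 then fmem le (v, c') R r else v = a) _ dx); last exact: fsub_adjoin.
split.
- by move=> [|c] v r s //; exact: Em.
- by move=> [|c] v v' r rp; [move=> -> ->|exact: Ef].
- by move=> [|c] r rp; [exists r => //; exists a|exact: Et].
- move=> [|c] v r rp; first by move=> ->; exact: adjoin_mem.
  by move=> /(Es _ _ _ rp) xv; exact: (@fsub_adjoin x a r).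
- move=> b r rp /fmem_adjoin[->|[s sr xb]]; first by exists r => //; exists 0.
  have [t ts [c Ec]] := Eo b s (le_trans sr rp) xb.
  by exists t; [exact: le_trans ts sr|exists c.+1].
Qed.

End Adjoin.

(** * Clubs in the extension *)

Section Clubs.
Context {d : Order.disp_t} {O : orderType d}.
Variables (W : set O) (C : @name P (@name P O)) (p : P).
Hypothesis C_club : fclub le (check W) C p.

Lemma fclub_cofinal x : fctbl_subset le (check W) x p ->
  exists y, fmem2 le y C p /\ fsub le x y p.
Proof.
move=> xW; have [_ [c2 _]] := C_club; have := c2 x p (le_refl p) xW.
apply: fex_full => [y|].
  by apply: stable_fand; [exact: stable_fmem_for|exact: stable_fsub].
move=> y z r yz [yC xy]; split; first exact: fmem2_respects yz yC.
exact: fsub_respects yz xy.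
Qed.

Lemma fclub_step x a : fmem2 le x C p -> W a ->
  exists y, [/\ fmem2 le y C p, fsub le x y p & fmem le a y p].
Proof.
move=> xC Wa; have [c1 _] := C_club; have [xW dx] := c1 x p (le_refl p) xC.
have [|y [yC xy]] := @fclub_cofinal (adjoin x a).
  split; last exact: fdenumerable_adjoin.
  move=> b q qp /fmem_adjoin[->|[r rq xb]]; first exact/fmem_check.
  by have /fmem_check Wb := xW b r (le_trans rq qp) xb; exact/fmem_check.
exists y; split=> //; first exact: fsub_trans (@fsub_adjoin _ x a p) xy.
by apply: xy => //; exact: adjoin_mem.
Qed.

(** The analogue in the extension of the members [phi e] above. The tuples are from the ground
    model, so the names [Phi e] and their enumerations [R e] are chosen in advance, and a condition
    only has to decide values. *)
Lemma fclub_family x0 : ctbl_subsets W x0 ->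
  exists (Phi : seq O -> @name P O) (R : seq O -> @name P (O * nat)),
    (forall e : seq O, (forall a, a \in e -> W a) ->
       fbijection (Phi e) (R e) p /\ fmem2 le (Phi e) C p) /\
    (forall (e : seq O) a, (forall b, b \in e -> W b) -> W a ->
       fsub le (Phi e) (Phi (rcons e a)) p /\ fmem le a (Phi (rcons e a)) p).
Proof.
move=> [x0W x0N].
have [|c0 [c0C _]] := @fclub_cofinal (check x0).
  split; last exact: fdenumerable_check.
  by move=> a q qp /fmem_check /x0W ?; exact/fmem_check.
have /choice[f fP] : forall z : O * @name P O, exists y, fmem2 le z.2 C p -> W z.1 ->
    [/\ fmem2 le y C p, fsub le z.2 y p & fmem le z.1 y p].
  move=> [a x] /=; have [[xC Wa]|N] := pselect (fmem2 le x C p /\ W a); last first.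
    by exists c0 => ? ?; case: N.
  by have [y yP] := fclub_step xC Wa; exists y.
(* The fold adds points at the head, so [Psi (rev e)] is what grows when a point is appended to
   [e]. *)
pose Psi := foldr (fun a x => f (a, x)) c0.
have PsiC e : (forall a, a \in e -> W a) -> fmem2 le (Psi e) C p.
  elim: e => // a e IH ey /=; have [| |//] := fP (a, Psi e).
    by apply: IH => b be; apply: ey; rewrite inE be orbT.
  by apply: ey; rewrite mem_head.
have revW e : (forall a, a \in e -> W a) -> forall a, a \in rev e -> W a.
  by move=> H a; rewrite mem_rev; exact: H.
have /choice[R RP] : forall e, exists R, (forall a, a \in e -> W a) ->
    fbijection (Psi (rev e)) R p.
  move=> e; have [/revW/PsiC H|N] := pselect (forall a, a \in e -> W a); last first.
    by exists set0.
  have [c1 _] := C_club; have [_ dx] := c1 _ p (le_refl p) H.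
  by have [R RP] := fdenumerable_full dx; exists R.
exists (fun e => Psi (rev e)), R; split=> [e eW|e a eW Wa].
  by split; [exact: RP|apply: PsiC; exact: revW].
rewrite rev_rcons /=.
by have [] := fP (a, Psi (rev e)) (PsiC _ (revW _ eW)) Wa.
Qed.

Lemma fclub_limit (X : nat -> @name P O) : (forall n, fmem2 le (X n) C p) ->
  (forall n, fsub le (X n) (X n.+1) p) -> exists z, [/\ fmem2 le z C p,
    forall n, fsub le (X n) z p &
    forall a r, le r p -> fmem le a z r -> exists2 s, le s r & exists n, fmem le a (X n) s].
Proof.
move=> XC Xinc.
(* Closure of a club speaks of one name of a sequence, so the names [X n] are glued to a name for a
   subset of the product. *)
pose X' : @name P (nat * O) := [set sx | X sx.2.1 (sx.1, sx.2.2)].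
have secX n : section_name X' n = X n.
  by apply/seteqP; split=> -[s a].
pose z := name_of (fun a => fex le (fun n => fmem le a (X n))).
have zP a r : fmem le a z r <-> fex le (fun n => fmem le a (X n)) r.
  apply: (@fmem_name_of _ (fun a => fex le (fun n => fmem le a (X n)))).
  exact: stable_fex.
exists z; split.
- have [_ [_ c3]] := C_club; apply: (c3 X' p (le_refl p) _ z p (le_refl p)).
    split=> n.
      by change (fmem2 le (section_name X' n) C p); rewrite secX.
    by change (fsub le (section_name X' n) (section_name X' n.+1) p); rewrite !secX.
  move=> a; split=> q qp.
    move=> /zP H s sq; have [t ts [n Hn]] := H s sq; exists t => //; exists n.
    by rewrite secX.
  move=> H; apply/zP => s sq; have [t ts [n Hn]] := H s sq; exists t => //; exists n.
  by move: Hn; rewrite secX.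
- move=> n a q qp Ha; apply/zP => s sq; exists s => //; exists n.
  exact: fmem_mono sq.
- by move=> a r rp /zP/(_ r (le_refl r)).
Qed.

End Clubs.

(** The elements of [e] are treated one after the other; as [G] is monotone in the condition and in
    the stage, the last condition and the largest stage serve for all. *)
Lemma gather (T : eqType) (G : nat -> T -> set P) (e : seq T) p :
  (forall m a r s, G m a r -> le s r -> G m a s) ->
  (forall m a r, G m a r -> G m.+1 a r) ->
  (forall a, a \in e -> forall r, le r p -> exists2 s, le s r & exists m, G m a s) ->
  forall r, le r p -> exists2 s, le s r & exists m, forall a, a \in e -> G m a s.
Proof.
move=> Gr Gm; elim: e => [|a e IH] H r rp; first by exists r => //; exists 0%N.
have Gle m n b s : (m <= n)%N -> G m b s -> G n b s.
  by move=> /subnKC <-; elim: (n - m)%N => [|i IHi]; rewrite ?addn0 // addnS => /IHi /Gm.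
have [|s sr [m Hm]] := IH _ r rp; first by move=> b be; apply: H; rewrite inE be orbT.
have [t ts [n Hn]] := H a (mem_head _ _) s (le_trans sr rp).
exists t; first exact: le_trans ts sr.
exists (maxn m n) => b; rewrite inE => /orP[/eqP->|/Hm H'].
  exact: Gle (leq_maxr _ _) Hn.
by apply: Gle (leq_maxl m n) _; exact: Gr ts.
Qed.

End ForcingBasics.

(** * Namba trees *)

Section Prefix.
Context {T : eqType}.
Implicit Types s t u : seq T.

Lemma nth_prefix x0 s t i : prefix s t -> (i < size s)%N -> nth x0 t i = nth x0 s i.
Proof. by move=> /prefixP[u ->] lt; rewrite nth_cat lt. Qed.

Lemma prefix_antisym s t : prefix s t -> prefix t s -> s = t.
Proof.
move=> /prefixP[u ->] /size_prefix; rewrite size_cat -{2}[size s]addn0 leq_add2l.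
by rewrite leqn0 size_eq0 => /eqP->; rewrite cats0.
Qed.

Lemma prefix_comparable s t u : prefix s u -> prefix t u -> prefix s t \/ prefix t s.
Proof.
rewrite !prefixE => /eqP s_u /eqP t_u.
have [le|le] := leqP (size s) (size t); [left|right].
  by rewrite -t_u take_takel // s_u.
by rewrite -s_u take_takel ?t_u // ltnW.
Qed.

End Prefix.

Section Main.
Context {d : Order.disp_t} {O : orderType d}.
Variables (O_wo : well_ordered O) (kappa lambda : O).
Hypothesis kappa_reg : is_regular kappa.
Hypothesis aleph2_le_kappa : omega2 `<=` below kappa.
Hypothesis kappa_le_lambda : kappa <= lambda.

Local Notation Pkl := (Pkl kappa lambda).
Local Notation Nm := (@Nm d O kappa lambda).
Local Notation le := (@Nm_le d O kappa lambda).
Local Notation W := (below lambda).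

(** * Sets of size less than kappa *)

Definition small T (X : set T) : Prop := card_lt X (below kappa).

Lemma not_omega2_kappa : ~ omega2 kappa.
Proof. by move=> /aleph2_le_kappa; rewrite /below /= ltxx. Qed.

Lemma small_omega1 : small (omega1 : set O).
Proof. by apply/card_ltP => /not_omega2_kappa. Qed.

Lemma not_omega1_kappa : ~ omega1 kappa.
Proof.
move=> ok; apply: not_omega2_kappa; apply: subset_card_le => b /= bk.
by apply: omega1_down ok _; exact: ltW.
Qed.

Lemma sub_omega1_kappa : omega1 `<=` below kappa.
Proof.
move=> a oa; rewrite /below /= ltNge; apply/negP => ka.
by apply: not_omega1_kappa; exact: omega1_down oa ka.
Qed.

Lemma small_countable T (X : set T) : countable X -> small X.
Proof.
move=> cX; apply/card_ltP => kX; apply: not_omega1_kappa.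
exact: sub_countable kX cX.
Qed.

Lemma sub_small T U (A : set T) (B : set U) : A #<= B -> small B -> small A.
Proof. exact: card_le_lt. Qed.

Lemma small_below (a : O) : a < kappa -> small (below a).
Proof. by case: kappa_reg => kc _ _ /kc. Qed.

Lemma small_bounded (X : set O) : X `<=` below kappa -> small X ->
  exists2 b, b < kappa & forall c, X c -> c < b.
Proof. by case: kappa_reg => _ _; exact. Qed.

(** By regularity, the image of an injection of [X] into [kappa] is bounded. *)
Lemma small_le_below T (X : set T) : small X ->
  exists2 b, b < kappa & X #<= below b.
Proof.
move=> sX; have [f [fk fi]] := card_le_funP kappa sX.1.
have [| |b bk bP] := @small_bounded (f @` X).
- by move=> _ [a Xa <-]; exact: fk.
- by apply: sub_small sX; exact: card_image_le.
exists b => //; apply: (card_le_inj (f := f)) => // a Xa.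
by apply: bP; exact: imageP.
Qed.

(** Suppose [g] injects [kappa] into the union. Regularity bounds the ordinals that [g] sends to
    [F i] by some [c i], and the [c i] by some [m]; then [g m] is in no [F i]. *)
Lemma small_bigcup (I T : Type) (Y : set I) (F : I -> set T) : small Y ->
  (forall i, Y i -> small (F i)) -> small (\bigcup_(i in Y) F i).
Proof.
move=> sY sF; apply/card_ltP => kU.
have [a0 ak] : below kappa !=set0.
  by case: kappa_reg => _ /infinite_setN0.
have [t0 _] : \bigcup_(i in Y) F i !=set0.
  apply/set0P/eqP => U0; move: kU; rewrite U0 card_le0 => /eqP k0.
  by have : below kappa a0 by []; rewrite k0.
have [g [gU gi]] := card_le_funP t0 kU.
have /choice[c cP] : forall i, exists c, Y i -> c < kappa /\
    forall b, b < kappa -> F i (g b) -> b < c.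
  move=> i; have [Yi|nY] := pselect (Y i); last by exists a0.
  have [| |c ck cP] := @small_bounded [set b | b < kappa /\ F i (g b)].
  - by move=> b [].
  - apply: sub_small (sF _ Yi); apply: (card_le_inj (f := g)) => [b []//|].
    by move=> b b' [bk _] [bk' _]; exact: gi.
  by exists c => _; split=> // b bk Fb; exact: cP.
have [| |m mk mP] := @small_bounded (c @` Y).
- by move=> _ [i /cP[ck _] <-].
- by apply: sub_small sY; exact: card_image_le.
have [i Yi Fi] := gU m mk.
have [_ /(_ _ mk Fi) mc] := cP i Yi.
by have := lt_trans mc (mP _ (imageP c Yi)); rewrite ltxx.
Qed.

Lemma smallU T (A B : set T) : small A -> small B -> small (A `|` B).
Proof.
move=> sA sB; rewrite -bigcup2E; apply: small_bigcup.
  exact: small_countable.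
by move=> [|[|i]] _ //=; exact: small_countable.
Qed.

Lemma Pkl_bigcup (I : Type) (Y : set I) (F : I -> set O) : small Y ->
  (forall i, Y i -> Pkl (F i)) -> Pkl (\bigcup_(i in Y) F i).
Proof.
move=> sY YF; split; last by apply: small_bigcup => // i /YF[].
by move=> a [i /YF[+ _]]; apply.
Qed.

Lemma PklU x y : Pkl x -> Pkl y -> Pkl (x `|` y).
Proof. by move=> [xl sx] [yl sy]; split; [rewrite subUset|exact: smallU]. Qed.

Lemma Pkl_countable x : x `<=` below lambda -> countable x -> Pkl x.
Proof. by move=> xl cx; split=> //; exact: small_countable. Qed.

Lemma Pkl_proper x : Pkl x -> exists y, [/\ Pkl y, x `<=` y & ~ y `<=` x].
Proof.
move=> px; have [xl sx] := px.
have [c cl nxc] : exists2 c, c < lambda & ~ x c.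
  apply: contrapT => H; move: sx => /card_ltP; apply.
  apply: subset_card_le => c /= ck; apply: contrapT => nxc; apply: H.
  by exists c => //; exact: lt_le_trans kappa_le_lambda.
exists (x `|` [set c]); split=> [|b xb|]; last 2 first.
- by left.
- by move=> /(_ c) xc; apply: nxc; apply: xc; right.
apply: PklU => //; apply: Pkl_countable => //.
by move=> _ ->.
Qed.

Definition reflecting_shape (R : set O) : Prop :=
  [/\ Pkl R, omega1 `<=` R & exists2 a, a < kappa & R `&` below kappa = below a].

(** Once [omega1] is added, the part below [kappa] is bounded by some [a]; filling in all ordinals
    below [a] makes it an initial segment. *)
Lemma reflecting_shape_cofinal x : Pkl x -> exists2 R, reflecting_shape R & x `<=` R.
Proof.
move=> px; have [xl sx] := px.
have below_kl : below kappa `<=` below lambda by exact: sub_below.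
have po : Pkl omega1.
  by split; [apply: subset_trans sub_omega1_kappa below_kl|exact: small_omega1].
have [_ sxo] := PklU px po.
have [||a ak aP] := @small_bounded ((x `|` omega1) `&` below kappa).
- by move=> b [].
- by apply: sub_small sxo; apply: subset_card_le => b [].
exists (x `|` omega1 `|` below a); last by move=> b xb; left; left.
split.
- apply: PklU; first exact: PklU.
  split; last exact: small_below.
  by apply: sub_below; apply: le_trans kappa_le_lambda; exact: ltW.
- by move=> b ob; left; right.
- exists a => //; apply/seteqP; split=> [b [[xb|//] bk]|b /= ba].
    by apply: aP.
  by split; [right|exact: lt_trans ak].
Qed.

(* If kappa > omega_2, then [R]^omega itself is small.  If kappa = omega_2, then
   [R]^omega may be large, but R has a filtration (Rd de) of length omega_1, and
   one element of S for every de is enough. *)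
Lemma small_semistationary (R : set O) (S : set (set O)) :
  (forall nu : O, is_cardinal nu ->
       omega2 `<=` below nu -> nu < kappa ->
       card_lt [set f : nat -> O | forall n, f n < nu] (below kappa)) ->
  Pkl R -> omega1 `<=` R -> S `<=` ctbl_subsets R -> semistationary R S ->
  exists Y : set (set O), [/\ Y `<=` S, small Y & forall h, preserved h R ->
    exists2 y, Y y & cl h y `&` omega1 `<=` y].
Proof.
move=> pow [Rl sR] oR SR SS.
have [a0 oa0] : (omega1 : set O) !=set0.
  apply/set0P/eqP => o0; apply: (omega1_uncountable O_wo not_omega1_kappa).
  by rewrite o0.
(* If some [c] below [kappa] has more than aleph_1 predecessors, the elements of [S] are coded by
   sequences of ordinals below a cardinal [nu] to which [pow] applies. *)
have [[c [ck no2]]|all2] := pselect (exists c, c < kappa /\ ~ omega2 c).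
  exists S; split=> //; last first.
    by move=> h hR; have [y [Sy _ yc]] := semistationary_cl SS hR; exists y.
  have [b bk /(card_le_funP a0)[f [fR fi]]] := small_le_below sR.
  pose m := Order.max b c.
  have mk : m < kappa by rewrite /m gt_max bk ck.
  (* [nu] is the cardinality of [m]; the bound on powers is given for cardinals. *)
  have [|nu nuP numin] := wo_min (A := [set n | below m #<= below n]) O_wo.
    by exists m => /=.
  have num : nu <= m by apply: numin => /=.
  have {}pow := pow nu.
  have [g [gm gi]] := card_le_funP a0 nuP.
  have : small [set f : nat -> O | forall n, f n < nu].
    apply: pow; last exact: le_lt_trans mk.
      move=> n nnu; apply/card_ltP => H; have : nu <= n.
        by apply: numin; apply: card_le_trans nuP H.
      by rewrite leNgt nnu.
    move=> e oe ; rewrite /below /= ltNge; apply/negP => nue; apply: no2.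
    apply: card_le_trans oe; apply: card_le_trans (subset_card_le (sub_below nue)).
    apply: card_le_trans nuP; apply: subset_card_le; apply: sub_below.
    by rewrite /m le_max lexx orbT.
  apply: sub_small.
  have /choice[en enP] : forall x : set O, exists u : nat -> O, S x -> x = range u.
    move=> x; have [/SR[_ /denumerable_enum[u xu]]|nS] := pselect (S x).
      by exists u.
    by exists (fun _ => a0).
  have enm x n : S x -> f (en x n) < m.
    move=> Sx; rewrite lt_max; apply/orP; left; apply: fR.
    have [xR _] := SR _ Sx; apply: xR.
    by rewrite {1}(enP x Sx); exists n.
  apply: (card_le_inj (f := fun x n => g (f (en x n)))).
    by move=> x Sx n; apply: gm; exact: enm.
  have key x x' : S x -> S x' ->
      (fun n => g (f (en x n))) = (fun n => g (f (en x' n))) -> x `<=` x'.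
    move=> Sx Sx' e; have [xR _] := SR _ Sx; have [xR' _] := SR _ Sx'.
    rewrite {1}(enP x Sx) => _ [n _ <-].
    have -> : en x n = en x' n.
      apply: fi.
      + by apply: xR; rewrite {1}(enP x Sx); exists n.
      + by apply: xR'; rewrite {1}(enP x' Sx'); exists n.
      + by apply: gi; [exact: enm|exact: enm|exact: (congr1 (fun F => F n) e)].
    by rewrite {1}(enP x' Sx'); exists n.
  by move=> x x' Sx Sx' e; apply/seteqP; split; apply: key.
have Ro : R #<= (omega1 : set O).
  have [b bk Rb] := small_le_below sR.
  apply: card_le_trans Rb _.
  by apply: contrapT => nb; apply: all2; exists b.
have [i [iR ii]] := card_le_funP a0 Ro.
pose Rd (de : O) := [set b | R b /\ i b < de].
(* One element of [S] is kept for each level [de] at which some element lies in [Rd de] and has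
   exactly the countable ordinals below [de]. *)
have /choice[yd ydP] : forall de, exists y,
    (exists y', [/\ S y', y' `<=` Rd de & y' `&` omega1 = below de]) ->
    [/\ S y, y `<=` Rd de & y `&` omega1 = below de].
  move=> de; have [[y yP]|n] := pselect (exists y', [/\ S y',
      y' `<=` Rd de & y' `&` omega1 = below de]); first by exists y.
  by exists set0.
exists (S `&` (yd @` omega1)); split.
- by move=> y [].
- apply: sub_small small_omega1; apply: card_le_trans (card_image_le yd _).
  by apply: subset_card_le => y [].
move=> h hR.
have /choice[f fP] : forall a, exists u : nat -> O, omega1 a ->
    (below a !=set0 -> below a = range u) /\ forall n, omega1 (u n).
  move=> a; have [[oa na]|n] := pselect (omega1 a /\ below a !=set0); last first.
    by exists (fun=> a0) => oa; split => // na; case: n.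
  have [u ua] := countable_enum oa na; exists u => _; split=> // n.
  apply: omega1_down oa _; apply: ltW; have : range u (u n) by exists n.
  by rewrite -ua.
have /choice[g gP] : forall a, exists b, R b /\
    ((exists2 b', R b' & i b' = a) -> i b = a).
  move=> a; have [[b Rb ib]|n] := pselect (exists2 b', R b' & i b' = a).
    by exists b.
  by exists a0; split; [exact: oR|].
pose hd := head a0.
pose code_type : countType := (nat + (nat + bool))%type.
(* Besides [h], this lists the predecessors of countable ordinals by [f] and applies [i] and its
   inverse [g]. The closure [z] below therefore meets [omega1] in an initial segment [de] and equals
   [Rd de]. *)
pose h' (e : seq O) (k : nat) : O := match @unpickle code_type k with
  | Some (inl j) => h e j
  | Some (inr (inl j)) => if pselect (omega1 (hd e)) then f (hd e) j else a0
  | Some (inr (inr true)) => if pselect (R (hd e)) then i (hd e) else a0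
  | Some (inr (inr false)) => g (hd e)
  | None => a0 end.
have Ra0 : R a0 by exact: oR.
have hR' : preserved h' R.
  move=> e k eR; rewrite /h'; case: unpickle => // -[j|[j|[]]].
  - exact: hR.
  - by case: pselect => //= oh; have [_ fo] := fP _ oh; apply: oR.
  - by case: pselect => // Rh; apply: oR; apply: iR.
  - by have [] := gP (hd e).
have [y [Sy yR yc]] := semistationary_cl SS hR'.
set z := cl h' y in yc.
have zR : z `<=` R by exact: cl_min.
have zh : preserved h z.
  move=> e k ez; have := @cl_step _ _ h' y e (@pickle code_type (inl k)) ez.
  by rewrite /h' pickleK.
have z1 a (zz : z a) b : b \in [:: a] -> z b by rewrite inE => /eqP->.
have zdown a b : z a -> omega1 a -> b < a -> z b.
  move=> za oa ba; have [/(_ (ex_intro _ b ba)) E _] := fP a oa.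
  have : below a b by []; rewrite E => -[n _ <-].
  have := @cl_step _ _ h' y [:: a] (@pickle code_type (inr (inl n))) (z1 a za).
  by rewrite /h' pickleK /=; case: pselect.
have zi a : z a -> z (i a).
  move=> za.
  have := @cl_step _ _ h' y [:: a] (@pickle code_type (inr (inr true))) (z1 a za).
  by rewrite /h' pickleK /=; case: pselect => // nR; case: nR; exact: zR.
have zg a : R a -> z (i a) -> z a.
  move=> Ra zia.
  have := @cl_step _ _ h' y [:: i a] (@pickle code_type (inr (inr false))) (z1 _ zia).
  rewrite /h' pickleK /=; have [Rg gi] := gP (i a).
  by rewrite (ii _ _ Rg Ra (gi (ex_intro2 _ _ a Ra erefl))).
(* [z] misses a countable ordinal, since its countable ordinals all lie in the countable set [y]. *)
have [|de [ode nzde] dmin] := wo_min (A := [set a | omega1 a /\ ~ z a]) O_wo.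
  apply: contrapT => H; apply: (omega1_uncountable O_wo not_omega1_kappa).
  have [_ /denumerable_countable] : ctbl_subsets R y by exact: SR.
  apply: sub_countable; apply: subset_card_le => a oa; apply: yc; split=> //.
  by apply: contrapT => nza; apply: H; exists a.
have zo : z `&` omega1 = below de.
  apply/seteqP; split=> [a [za oa]|a /= ad].
    rewrite /below /= ltNge; apply/negP; rewrite le_eqVlt => /orP[/eqP e|da].
      by apply: nzde; rewrite e.
    by apply: nzde; exact: zdown da.
  have oa : omega1 a by apply: omega1_down ode _; exact: ltW.
  split=> //; apply: contrapT => nza; have : de <= a by apply: dmin.
  by rewrite leNgt ad.
have zRd : z = Rd de.
  apply/seteqP; split=> [a za|a [Ra ia]]; last first.
    by apply: zg => //; have : below de (i a) by []; rewrite -zo => -[].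
  split; first exact: zR.
  have : (z `&` omega1) (i a) by split; [exact: zi|apply: iR; exact: zR].
  by rewrite zo.
have [|Sd ydR ydo] := ydP de.
  exists y; split=> //; first by rewrite -zRd; exact: sub_cl.
  rewrite -zo; apply/seteqP; split=> a [ya oa]; split=> //; first exact: sub_cl.
  exact: yc.
(* The closure of [yd de] under [h] stays in [Rd de], whose countable ordinals are below [de] and
   hence in [yd de]. *)
exists (yd de); first by split=> //; exact: imageP.
move=> a [ca oa].
have : (z `&` omega1) a.
  by split=> //; apply: cl_min ca => //; rewrite zRd.
by rewrite zo -ydo => -[].
Qed.

Lemma Pkl_set0 : Pkl set0.
Proof. exact: Pkl_countable. Qed.

#[local] Hint Resolve Pkl_set0 : core.

Lemma omega1_infinite : infinite_set (omega1 : set O).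
Proof.
move=> /finite_set_countable.
exact: (omega1_uncountable O_wo not_omega1_kappa).
Qed.

Lemma omega1_lambda : omega1 `<=` W.
Proof.
apply: subset_trans sub_omega1_kappa _; exact: sub_below.
Qed.

Lemma ctbl_subsets_neq0 (V : set O) : omega1 `<=` V -> exists x, ctbl_subsets V x.
Proof.
move=> oV; have /infiniteP := omega1_infinite.
move=> /(card_le_funP kappa)[f [fo fi]]; exists (range f).
split; first by move=> _ [n _ <-]; apply: oV; apply: fo.
apply: inj_card_eq => n m _ _ e; exact: fi.
Qed.

(** * Namba trees for the bounded ideal and their trunks *)

Implicit Types (t : seq (set O)) (T : set (seq (set O))) (p q r : Nm).

Definition unbounded (A : set (set O)) : Prop :=
  forall b, Pkl b -> exists2 a, A a & b `<=` a.

(** Namba trees with the trunk named: positivity becomes unboundedness, and maximality of the trunk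
    follows from the branching above it. *)
Record tree_with_trunk t T : Prop := TreeWithTrunk {
  tree_incr : T `<=` increasing_seq kappa lambda;
  tree_down : forall s u, T u -> prefix s u -> T s;
  tree_trunk : T t;
  tree_comp : forall s, T s -> prefix s t \/ prefix t s;
  tree_suc : forall s, T s -> prefix t s -> unbounded (Suc T s) }.

Lemma Suc_Pkl T s a : T `<=` increasing_seq kappa lambda -> Suc T s a -> Pkl a.
Proof.
move=> /(_ (rcons s a)) Ti /Ti[/(_ (size s))].
by rewrite size_rcons nth_rcons ltnn eqxx => /(_ (ltnSn _)).
Qed.

Lemma tree_suc2 t T s : tree_with_trunk t T -> T s -> prefix t s ->
  exists a a', [/\ Suc T s a, Suc T s a' & a <> a'].
Proof.
move=> Tt Ts ts; have su := tree_suc Tt Ts ts.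
have [a sa _] := su _ Pkl_set0.
have [y [py ay nya]] := Pkl_proper (Suc_Pkl (tree_incr Tt) sa).
have [a' sa' ya'] := su _ py; exists a, a'; split=> // e.
by apply: nya; rewrite e.
Qed.

(** Two different successors of [t] cannot both be comparable with a proper extension of [t]. *)
Lemma trunk_maximal t T u : tree_with_trunk t T -> prefix t u ->
  (forall a, Suc T t a -> prefix (rcons t a) u \/ prefix u (rcons t a)) -> u = t.
Proof.
move=> Tt /prefixP[[|c v] ->] ucomp; first by rewrite cats0.
have [a [a' [sa sa' ne]]] := tree_suc2 Tt (tree_trunk Tt) (prefix_refl _).
have key b : Suc T t b -> b = c.
  by move=> /ucomp; rewrite -cats1 !prefix_catr // !eqxx /= => -[] /andP[/eqP->].
by case: ne; rewrite (key a) // (key a').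
Qed.

Lemma sub_trunk t T t' T' : tree_with_trunk t T -> tree_with_trunk t' T' ->
  T' `<=` T -> prefix t t'.
Proof.
move=> Tt Tt' sub; have t'T := sub _ (tree_trunk Tt').
have [t't|//] := tree_comp Tt t'T.
rewrite (trunk_maximal Tt' t't) ?prefix_refl // => a /sub Ta.
exact: (tree_comp Tt Ta).
Qed.

Lemma tree_is_trunk t T : tree_with_trunk t T -> is_trunk T t.
Proof.
move=> Tt; split; first exact: (tree_trunk Tt).
  exact: (tree_comp Tt).
move=> u Tu ucomp; have [//|tu] := tree_comp Tt Tu.
by rewrite (trunk_maximal Tt tu) ?prefix_refl // => a /ucomp.
Qed.

Lemma tree_Namba t T : tree_with_trunk t T ->
  Namba_tree kappa lambda (bounded_ideal kappa lambda) T.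
Proof.
move=> Tt; split; [exact: (tree_incr Tt)|exact: (tree_down Tt)|].
exists t; first exact: tree_is_trunk.
move=> s Ts ts; split; first by move=> a; apply: Suc_Pkl; exact: tree_incr Tt.
move=> [_ [y py H]]; have [a sa ya] := tree_suc Tt Ts ts py.
exact: H sa ya.
Qed.

Lemma Namba_treeP T : Namba_tree kappa lambda (bounded_ideal kappa lambda) T ->
  exists t, tree_with_trunk t T.
Proof.
move=> [Ti Td [t [Tt tc tm] ts]]; exists t; split=> //.
move=> s Ts tps b pb; have [su nb] := ts s Ts tps.
apply: contrapT => H; apply: nb; split=> //; exists b => // a sa ba.
by apply: H; exists a.
Qed.

Definition trunk p : seq (set O) := sval (cid (Namba_treeP (svalP p))).

Lemma trunkP p : tree_with_trunk (trunk p) (sval p).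
Proof. by rewrite /trunk; case: cid. Qed.

Definition Nm_of t T (Tt : tree_with_trunk t T) : Nm := exist _ T (tree_Namba Tt).

Lemma trunk_unique t p : tree_with_trunk t (sval p) -> trunk p = t.
Proof.
move=> H; apply: prefix_antisym; first exact: sub_trunk (trunkP p) H _.
exact: sub_trunk H (trunkP p) _.
Qed.

Lemma trunk_Nm_of t T (Tt : tree_with_trunk t T) : trunk (Nm_of Tt) = t.
Proof. exact: trunk_unique. Qed.

Lemma Nm_le_refl p : le p p. Proof. by []. Qed.

Lemma Nm_le_trans q p r : le p q -> le q r -> le p r.
Proof. exact: subset_trans. Qed.

Arguments Nm_le_refl p : clear implicits.
Arguments Nm_le_trans [q p r] _ _.

Local Notation fmem_mono := (fmem_mono Nm_le_refl Nm_le_trans).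
Local Notation fmem_check := (fmem_check Nm_le_refl Nm_le_trans).
Local Notation fbijection_enum := (fbijection_enum Nm_le_refl Nm_le_trans).
Local Notation stable_fmem := (stable_fmem Nm_le_refl Nm_le_trans).
Local Notation stable_fmem_for := (stable_fmem_for Nm_le_refl Nm_le_trans).
Local Notation stable_fsub := (stable_fsub Nm_le_refl Nm_le_trans).
Local Notation fdenumerable_enum := (fdenumerable_enum Nm_le_refl Nm_le_trans).
Local Notation fdenumerable_full := (fdenumerable_full Nm_le_refl Nm_le_trans).

Lemma Nm_le_trunk p q : le q p -> prefix (trunk p) (trunk q).
Proof. exact: sub_trunk (trunkP p) (trunkP q). Qed.

Definition Succ p : set (set O) := Suc (sval p) (trunk p).

Lemma Succ_unbounded p : unbounded (Succ p).
Proof. by have [_ _ Tt _ Ts] := trunkP p; apply: Ts Tt _; exact: prefix_refl. Qed.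

(** The nodes comparable with the extended trunk form the required tree. The premise sits inside the
    existential so that [res] becomes a total function. *)
Lemma res_subproof p a : exists q, Succ p a -> le q p /\
  trunk q = rcons (trunk p) a.
Proof.
have [sa|ns] := pselect (Succ p a); last by exists p.
have [Ti Td Tt Tc Ts] := trunkP p.
set t := rcons (trunk p) a.
have H : tree_with_trunk t [set s | sval p s /\ (prefix s t \/ prefix t s)].
  split.
  - by move=> s [/Ti].
  - move=> s u [Tu uc] su; split; first exact: Td su.
    have [ut|tu] := uc; first by left; exact: prefix_trans su ut.
    exact: prefix_comparable su tu.
  - by split=> //; left; exact: prefix_refl.
  - by move=> s [].
  - move=> s [Tps _] ts b pb; have [|a' sa' ba'] := Ts s Tps _ b pb.
      by apply: prefix_trans ts; exact: prefix_rcons.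
    exists a' => //; split=> //; right; apply: prefix_trans ts _; exact: prefix_rcons.
exists (Nm_of H) => _; split; first by move=> s [].
exact: trunk_Nm_of.
Qed.

Definition res p a : Nm := sval (cid (res_subproof p a)).

Lemma res_le p a : Succ p a -> le (res p a) p.
Proof. by rewrite /res; case: cid => q H /H[]. Qed.

Lemma res_trunk p a : Succ p a -> trunk (res p a) = rcons (trunk p) a.
Proof. by rewrite /res; case: cid => q H /H[]. Qed.

(** * The game *)

Section Family.
Variables (R : set O) (Y : set (set O)).
Hypothesis R_Pkl : Pkl R.
Hypothesis omega1_R : omega1 `<=` R.
Hypothesis Y_R : Y `<=` ctbl_subsets R.
Hypothesis Y_small : small Y.
Hypothesis Y_cl : forall h, preserved h R -> exists2 y, Y y & cl h y `&` omega1 `<=` y.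

Section Game.
(* D e v p: the condition p decides that v is the value asked for by e. *)
Variables (p0 : Nm) (D : seq O -> O -> set Nm).
Hypothesis D_mono : forall e v p q, D e v p -> le q p -> D e v q.
Hypothesis D_tot : forall (e : seq O) p, (forall a, a \in e -> below lambda a) ->
  le p p0 -> exists2 q, le q p & exists v, D e v q.

(** These are the direct extensions of Prikry-type arguments. *)
Definition pure p' p : Prop := le p' p /\ trunk p' = trunk p.

Definition decidable e p : Prop := exists p', pure p' p /\ exists v, D e v p'.

Definition good (y : set O) e p : Prop := exists v, D e v p /\ (omega1 v -> y v).

Lemma good_mono y e p q : good y e p -> le q p -> good y e q.
Proof. by move=> [v [Dv vy]] qp; exists v; split=> //; exact: D_mono qp. Qed.

Section Play.
Variables (y : set O) (u : nat -> O).
Local Notation task n := (mkseq u n).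

(* In a state (p, n) the tasks below n are done.  If a pure extension of p
   settles task n, the second player has to pass to one with a good value. *)
Definition turn p n p' n' : Prop :=
  [/\ decidable (task n) p, pure p' p, good y (task n) p' & n' = n.+1] \/
  [/\ ~ decidable (task n) p, p' = p & n' = n].

(* The first player answers with a bound b, above which the second player has
   to choose the next element of the sequence. *)
Inductive lost : Nm -> nat -> Prop :=
| Lost p n (b : Nm -> nat -> set O) :
    (forall p' n', turn p n p' n' -> Pkl (b p' n')) ->
    (forall p' n' a, turn p n p' n' -> Succ p' a -> b p' n' `<=` a ->
       lost (res p' a) n') -> lost p n.

Lemma not_lost p n : ~ lost p n -> exists s : Nm * nat, turn p n s.1 s.2 /\
  forall b, Pkl b -> exists a, [/\ Succ s.1 a, b `<=` a & ~ lost (res s.1 a) s.2].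
Proof.
move=> nl; apply: contrapT => H; apply: nl.
have /choice[b bP] : forall s : Nm * nat, exists b, turn p n s.1 s.2 ->
    Pkl b /\ forall a, Succ s.1 a -> b `<=` a -> lost (res s.1 a) s.2.
  move=> s; have [ms|nm] := pselect (turn p n s.1 s.2); last by exists set0.
  apply: contrapT => nb; apply: H; exists s; split=> // b pb.
  apply: contrapT => na; apply: nb; exists b => _; split=> // a sa ba.
  by apply: contrapT => nl; apply: na; exists a.
apply: (Lost (b := fun p n => b (p, n))) => p' n'.
  by move=> m; have [] := bP (p', n') m.
by move=> a m; have [_] := bP (p', n') m; apply.
Qed.

(* A strategy of the first player depends on the history, so that following it
   means descending in a derivation of [lost]. *)
Lemma lost_strategy p n : lost p n ->
  exists2 sg : seq (Nm * nat * set O) -> Nm * nat -> set O,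
    forall hist cur, Pkl (sg hist cur) &
    forall (st : nat -> Nm * nat) (mv : nat -> Nm * nat * set O), st 0 = (p, n) ->
      (forall i, [/\ turn (st i).1 (st i).2 (mv i).1.1 (mv i).1.2,
        Succ (mv i).1.1 (mv i).2, sg (mkseq mv i) (mv i).1 `<=` (mv i).2 &
        st i.+1 = (res (mv i).1.1 (mv i).2, (mv i).1.2)]) -> False.
Proof.
elim=> {}p {}n b bP _ IH.
have /choice[f fP] : forall z : Nm * nat * set O,
    exists sg : seq (Nm * nat * set O) -> Nm * nat -> set O,
    (forall hist cur, Pkl (sg hist cur)) /\
    (turn p n z.1.1 z.1.2 -> Succ z.1.1 z.2 -> b z.1.1 z.1.2 `<=` z.2 ->
    forall (st : nat -> Nm * nat) (mv : nat -> Nm * nat * set O),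
      st 0 = (res z.1.1 z.2, z.1.2) ->
      (forall i, [/\ turn (st i).1 (st i).2 (mv i).1.1 (mv i).1.2,
        Succ (mv i).1.1 (mv i).2, sg (mkseq mv i) (mv i).1 `<=` (mv i).2 &
        st i.+1 = (res (mv i).1.1 (mv i).2, (mv i).1.2)]) -> False).
  move=> [[p' n'] a] /=.
  have [[m sa ba]|N] := pselect [/\ turn p n p' n', Succ p' a & b p' n' `<=` a].
    by have [sg sgP sgF] := IH p' n' a m sa ba; exists sg.
  by exists (fun _ _ => set0); split=> // m sa ba; case: N.
(* On a nonempty history the strategy is that of the position reached by its first move; at the
   start it is the bound [b]. *)
exists (fun hist cur => if hist is z :: hist' then f z hist' cur else
   if pselect (turn p n cur.1 cur.2) then b cur.1 cur.2 else set0).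
  move=> [|z hist] [p' n'] /=; last by have [] := fP z.
  by case: pselect => //= m; exact: bP.
move=> st mv st0 play; have [] := play 0; rewrite st0 /=.
case: pselect => //= m _ sa ba st1; have [_ /(_ m sa ba)] := fP (mv 0).
move=> /(_ (fun i => st i.+1) (fun i => mv i.+1) st1); apply=> i.
have [m' sa' sg' st'] := play i.+1; split=> //.
suff -> : mkseq (fun i => mv i.+1) i = behead (mkseq mv i.+1) by [].
by rewrite /mkseq /= -[1%N]addn0 iotaDl -map_comp.
Qed.

Lemma turn_facts p n p' n' : turn p n p' n' -> [/\ le p' p, trunk p' = trunk p,
  (n <= n')%N & forall j, (n <= j < n')%N -> good y (task j) p'].
Proof.
case=> [[_ [lep tr] g ->]|[_ -> ->]]; split=> // j.
  by rewrite ltnS -eqn_leq => /eqP <-.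
by move=> /andP[jn /(leq_ltn_trans jn)]; rewrite ltnn.
Qed.

(** With a reply [stp] fixed in every position that is not lost, the answers that never lead to a
    lost position form a Namba tree [q]. Every condition below [q] is below the position reached by
    its trunk, where the completed tasks have good values. *)
Lemma not_lost_tree : (forall n, below lambda (u n)) -> ~ lost p0 0 ->
  exists2 q, le q p0 & forall n r, le r q ->
    exists2 s, le s r & good y (task n) s.
Proof.
move=> ul nl0.
have /choice[stp stpP] : forall s : Nm * nat, exists s' : Nm * nat, ~ lost s.1 s.2 ->
    turn s.1 s.2 s'.1 s'.2 /\ forall b, Pkl b ->
      exists a, [/\ Succ s'.1 a, b `<=` a & ~ lost (res s'.1 a) s'.2].
  move=> s; have [l|/not_lost[s' H]] := pselect (lost s.1 s.2); first by exists s.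
  by exists s'.
pose nxt (s : Nm * nat) a := (res (stp s).1 a, (stp s).2).
pose ok1 (s : Nm * nat) a := Succ (stp s).1 a /\ ~ lost (nxt s a).1 (nxt s a).2.
pose run := foldl nxt.
pose ok := fix ok (s : Nm * nat) (l : seq (set O)) : Prop :=
  if l is a :: l' then ok1 s a /\ ok (nxt s a) l' else True.
have ok_cat l m s : ok s (l ++ m) <-> ok s l /\ ok (run s l) m.
  elim: l s => [|a l IH] s /=; first by split=> [|[]].
  by rewrite IH; split=> [[? []]|[[? ?] ?]].
have run_inv l s : ~ lost s.1 s.2 -> ok s l -> [/\ ~ lost (run s l).1 (run s l).2,
    trunk (run s l).1 = trunk s.1 ++ l, le (run s l).1 s.1,
    (s.2 <= (run s l).2)%N &
    forall j, (s.2 <= j < (run s l).2)%N -> good y (task j) (run s l).1].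
  elim/last_ind: l => [|l a IH] nl /=.
    move=> _; split=> //; first by rewrite cats0.
    by move=> j /andP[js /(leq_ltn_trans js)]; rewrite ltnn.
  rewrite -cats1 => /ok_cat[okl [[sa nla] _]].
  have [nl' tr lep le2 g] := IH nl okl.
  have [m _] := stpP _ nl'; have [mle mtr mn mg] := turn_facts m.
  rewrite /run foldl_cat /= -/(run s l).
  have rle := res_le sa; split=> //.
  - by rewrite res_trunk // mtr tr -cats1 catA.
  - exact: Nm_le_trans rle (Nm_le_trans mle lep).
  - exact: leq_trans mn.
  - move=> j /andP[sj jn].
    have [lt|ge] := ltnP j (run s l).2.
      apply: (@good_mono _ _ (run s l).1); first by apply: g; rewrite sj.
      exact: Nm_le_trans rle mle.
    by apply: good_mono rle; apply: mg; rewrite ge.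
pose s0 := (p0, 0%N); pose t0 := trunk p0.
have T0 := trunkP p0.
pose Q : set (seq (set O)) := [set s | prefix s t0 \/ exists2 l, s = t0 ++ l & ok s0 l].
have run0 l : ok s0 l -> [/\ ~ lost (run s0 l).1 (run s0 l).2,
    trunk (run s0 l).1 = t0 ++ l, le (run s0 l).1 p0 &
    forall j, (j < (run s0 l).2)%N -> good y (task j) (run s0 l).1].
  by move=> okl; have [? ? ? _ g] := @run_inv l s0 nl0 okl.
have Qlong s : Q s -> prefix t0 s -> exists2 l, s = t0 ++ l & ok s0 l.
  move=> [st ts|//]; exists [::] => //; rewrite cats0.
  exact: prefix_antisym.
have HQ : tree_with_trunk t0 Q.
  split.
  - move=> s [st|[l -> okl]]; apply: (tree_incr T0).
      exact: tree_down T0 _ _ (tree_trunk T0) st.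
    have [_ <- lep _] := run0 l okl; apply: lep; exact: tree_trunk (trunkP _).
  - move=> s v Qv sv; case: Qv => [vt|[l El okl]].
      by left; exact: prefix_trans sv vt.
    rewrite El in sv.
    have [|ts] := prefix_comparable sv (prefix_prefix t0 l); first by left.
    right; move: ts sv => /prefixP[m ->]; rewrite prefix_catr // eqxx /= => /prefixP[m' E].
    by exists m => //; move: okl; rewrite E => /ok_cat[].
  - by right; exists [::]; rewrite ?cats0.
  - by move=> s [|[l -> _]]; [left|right; exact: prefix_prefix].
  - move=> s Qs /(Qlong _ Qs)[l -> okl] b pb.
    have [nl _ _ _] := run0 l okl; have [_ /(_ b pb)[a [sa ba nla]]] := stpP _ nl.
    exists a => //; right; exists (rcons l a); first by rewrite rcons_cat.
    by rewrite -cats1; apply/ok_cat; split.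
pose q : Nm := Nm_of HQ; have tq : trunk q = t0 by exact: trunk_Nm_of.
have ltrunk r : le r q -> exists2 l, trunk r = t0 ++ l & ok s0 l /\ le r (run s0 l).1.
  move=> rq; have Tr := trunkP r.
  have pre : prefix t0 (trunk r) by rewrite -tq; exact: Nm_le_trunk.
  have [l El okl] := Qlong _ (rq _ (tree_trunk Tr)) pre.
  have [nl trl lep _] := run0 l okl; have Tl := trunkP (run s0 l).1.
  exists l => //; split=> // s rs.
  have [st|ts] := tree_comp Tr rs.
    by apply: (tree_down Tl) (tree_trunk Tl) _; rewrite trl -El.
  have [l' El' okl'] := Qlong _ (rq _ rs) (prefix_trans pre ts).
  move: ts; rewrite El' El prefix_catr // eqxx /= => /prefixP[m E].
  move: okl'; rewrite E => /ok_cat[_ okm].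
  have [_ trm lem _ _] := run_inv m _ nl okm; apply: lem.
  have -> : t0 ++ l ++ m = trunk (run (run s0 l) m).1 by rewrite trm trl catA.
  exact: tree_trunk (trunkP _).
have qp0 : le q p0.
  have [l _ [okl ql]] := ltrunk q (@Nm_le_refl q).
  by have [_ _ lep _] := run0 l okl; exact: Nm_le_trans lep.
exists q => //.
(* It remains to see that the number of completed tasks is densely at least [n]. *)
suff reach n r : le r q -> exists2 s, le s r &
    exists2 l, trunk s = t0 ++ l & [/\ ok s0 l, le s (run s0 l).1 & (n <= (run s0 l).2)%N].
  move=> n r rq; have [s sr [l _ [okl sl nl]]] := reach n.+1 r rq.
  by exists s => //; have [_ _ _ g] := run0 l okl; apply: good_mono sl; exact: g.
elim: n r => [|n IH] r rq.
  by exists r => //; have [l El [okl rl]] := ltrunk r rq; exists l.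
have [s sr [l El [okl sl]]] := IH r rq.
have sq := Nm_le_trans sr rq.
rewrite leq_eqVlt => /orP[/eqP e|lt]; last by exists s => //; exists l.
have [|w ws [v Dv]] := @D_tot (task n) s _ (Nm_le_trans sq qp0).
  by move=> a /mapP[i _ ->].
have [l' El' [okl' wl']] := ltrunk w (Nm_le_trans ws sq).
have [lt|ge] := ltnP n (run s0 l').2.
  by exists w; [exact: Nm_le_trans ws sr|exists l'].
have e' : (run s0 l').2 = n.
  apply/eqP; rewrite eqn_leq ge /= e.
  have := Nm_le_trunk ws; rewrite El El' prefix_catr // eqxx /= => /prefixP[m E].
  move: okl'; rewrite E => /ok_cat[_ okm].
  have [nl _ _ _] := run0 l okl.
  by have [_ _ _ + _] := run_inv m _ nl okm; rewrite /run foldl_cat.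
(* The reply at the position of [w] takes effect only with the next entry of the trunk, so one more
   entry is added. *)
have [a sa _] := @Succ_unbounded w _ Pkl_set0.
have ra := res_le sa; have rt := res_trunk sa.
have req : le (res w a) q by exact: Nm_le_trans ra (Nm_le_trans ws sq).
exists (res w a); first exact: Nm_le_trans ra (Nm_le_trans ws sr).
have [k Ek [okk rk]] := ltrunk _ req; exists k => //; split=> //.
have Ekl : k = rcons l' a.
  have E : t0 ++ k = t0 ++ rcons l' a by rewrite -Ek rt El' rcons_cat.
  by have := congr1 (drop (size t0)) E; rewrite !drop_size_cat.
rewrite Ekl -cats1 /run foldl_cat /= -/(run s0 l').
have [nl trl _ _] := run0 l' okl'; have [m _] := stpP _ nl.
case: m => [[_ _ _ ->]|[nd _ _]]; first by rewrite e'.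
(* [w] itself is a pure extension of that position that decides task [n], so the idle turn is
   impossible. *)
by case: nd; rewrite e'; exists w; split; [split=> //; rewrite trl|exists v].
Qed.

End Play.

(** If all positions were lost, each answer could be taken above the bounds of all strategies at
    once, as [Y] is small. The decision at stage [i] depends only on the first [i] terms of the
    enumeration of [y], so the decisions define a function [h]. Some [y] gains no countable ordinals
    under [h]; its play is legal and beats its strategy. *)
Lemma exists_not_lost (en : set O -> nat -> O) :
  (forall y, Y y -> y = range (en y)) -> exists2 y, Y y & ~ lost y (en y) p0 0.
Proof.
move=> en_range; apply: contrapT => H.
have allL y : Y y -> lost y (en y) p0 0.
  by move=> Yy; apply: contrapT => nl; apply: H; exists y.
have [r0 or0] := infinite_setN0 omega1_infinite.
have /choice[sg sgP] : forall y, exists sg : seq (Nm * nat * set O) -> Nm * nat -> set O,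
    (forall hist cur, Pkl (sg hist cur)) /\ (Y y ->
    forall (st : nat -> Nm * nat) (mv : nat -> Nm * nat * set O), st 0 = (p0, 0%N) ->
      (forall i, [/\ turn y (en y) (st i).1 (st i).2 (mv i).1.1 (mv i).1.2,
        Succ (mv i).1.1 (mv i).2, sg (mkseq mv i) (mv i).1 `<=` (mv i).2 &
        st i.+1 = (res (mv i).1.1 (mv i).2, (mv i).1.2)]) -> False).
  move=> y; have [/allL/lost_strategy[sg sg1 sg2]|nY] := pselect (Y y); first by exists sg.
  by exists (fun _ _ => set0); split.
have /choice[al alP] : forall z : seq (Nm * nat * set O) * (Nm * nat), exists a,
    Succ z.2.1 a /\ forall y, Y y -> sg y z.1 z.2 `<=` a.
  move=> z; have [|a sa Ba] := @Succ_unbounded z.2.1 (\bigcup_(y in Y) sg y z.1 z.2).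
    by apply: Pkl_bigcup => // y _; have [] := sgP y.
  by exists a; split=> // y Yy b yb; apply: Ba; exists y.
have /choice[pi piP] : forall z : Nm * seq O, exists w : Nm * O,
    decidable z.2 z.1 -> pure w.1 z.1 /\ D z.2 w.2 w.1.
  move=> z; have [[p' [pu [v Dv]]]|nd] := pselect (decidable z.2 z.1).
    by exists (p', v).
  by exists (z.1, r0).
pose cur (u : nat -> O) (s : Nm * nat) : Nm * nat :=
  if pselect (decidable (mkseq u s.2) s.1) then ((pi (s.1, mkseq u s.2)).1, s.2.+1) else s.
pose mvs (u : nat -> O) (s : Nm * nat * seq (Nm * nat * set O)) : Nm * nat * set O :=
  (cur u s.1, al (s.2, cur u s.1)).
pose next u s := let m := mvs u s in ((res m.1.1 m.2, m.1.2), rcons s.2 m).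
pose st u i := iter i (next u) (p0, 0%N, [::]).
(* Values that are not countable ordinals do not matter for [good]; replacing them by [r0] keeps [h]
   inside [R]. *)
pose vl u i := let s := (st u i).1 in let v := (pi (s.1, mkseq u s.2)).2 in
  if pselect (omega1 v) then v else r0.
(* At stage [i] at most [i] tasks are done, hence only the first [i] terms of [u] have been used. *)
have st_le u i : ((st u i).1.2 <= i)%N.
  elim: i => // i IH; rewrite /st iterS -/(st u i) /next /mvs /cur /=.
  by case: pselect => _ /=; rewrite ?ltnS // ltnW.
have mk_eq (u u' : nat -> O) n :
    (forall j, (j < n)%N -> u j = u' j) -> mkseq u n = mkseq u' n.
  by move=> e; apply/eq_in_map => j; rewrite mem_iota => /e.
have st_eq u u' i : (forall j, (j < i)%N -> u j = u' j) -> st u i = st u' i.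
  elim: i => // i IH e; rewrite /st !iterS -/(st u i) -/(st u' i) IH; last first.
    by move=> j ji; apply: e; exact: ltnW.
  rewrite /next /mvs /cur (@mk_eq u u') // => j jn; apply: e.
  by apply: leq_trans jn _; apply: leq_trans (st_le u' i) _.
have vl_eq u u' i : (forall j, (j < i)%N -> u j = u' j) -> vl u i = vl u' i.
  move=> e; rewrite /vl (st_eq _ _ _ e) (@mk_eq u u') // => j jn.
  by apply: e; apply: leq_trans jn (st_le _ _).
(* The tuple [e] is read as the beginning of an enumeration, and its length is the stage. *)
pose h (e : seq O) (k : nat) := vl (nth r0 e) (size e).
have hR : preserved h R.
  by move=> e k _; rewrite /h /vl; case: pselect => [ov|_] /=; apply: omega1_R.
have [y Yy yc] := Y_cl hR.
have vl_cl i : cl h y (vl (en y) i).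
  have -> : vl (en y) i = h (mkseq (en y) i) 0.
    by rewrite /h size_mkseq; apply: vl_eq => j ji; rewrite nth_mkseq.
  apply: cl_step => a /mapP[j _ ->]; apply: cl_base; rewrite {1}(en_range _ Yy).
  by exists j.
have [_ /(_ Yy)] := sgP y.
move=> /(_ (fun i => (st (en y) i).1) (fun i => mvs (en y) (st (en y) i)) erefl); apply=> i.
have hist : (st (en y) i).2 = mkseq (fun i => mvs (en y) (st (en y) i)) i.
  elim: i => // i IH; rewrite mkseqS -IH /st iterS -/(st _ i).
  by [].
have [sa ba] := alP ((st (en y) i).2, cur (en y) (st (en y) i).1).
split=> //; last by rewrite -hist; exact: ba.
rewrite /mvs /= /cur; case: pselect => [dec|nd] /=; last by right.
have [pu Dv] := piP ((st (en y) i).1.1, mkseq (en y) (st (en y) i).1.2) dec.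
left; split=> //.
exists (pi ((st (en y) i).1.1, mkseq (en y) (st (en y) i).1.2)).2; split=> // ov.
by apply: yc; split=> //; have := vl_cl i; rewrite /vl /=; case: pselect.
Qed.

Lemma game : exists y u q, [/\ Y y, y = range u, le q p0 & forall n r, le r q ->
    exists2 s, le s r & good y (mkseq u n) s].
Proof.
have /choice[en enP] : forall y, exists u : nat -> O, Y y -> y = range u.
  move=> y; have [/Y_R[_ /denumerable_enum[u E]]|N] := pselect (Y y); first by exists u.
  by exists (fun _ => kappa).
have [y Yy nl] := exists_not_lost enP.
have yE := enP y Yy.
have [n|q qp H] := not_lost_tree _ nl; last by exists y, (en y), q.
have [RW _] := R_Pkl; have [yR _] := Y_R Yy; apply: RW; apply: yR.
by rewrite {1}yE; exists n.
Qed.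

End Game.

(** If [a] were uncountable, take a name [N] of an injection of [a] into omega and let task [n] ask
    for the preimage of [n]. The game would put all of [omega1] into the countable set [y]. *)
Lemma omega1_preserved (p : Nm) (a : O) : fomega1 le a p -> omega1 a.
Proof.
move=> ap; apply: contrapT => na.
have [q qp [N [dom [_ inj]]]] := ap p (Nm_le_refl p).
have [r0 or0] := infinite_setN0 omega1_infinite.
(* The default [r0] is decided when no extension puts anything at this number, so every question has
   an answer. *)
pose D (e : seq O) v : set Nm := [set s | fmem le (v, size e) N s \/
  v = r0 /\ forall s' w, le s' s -> ~ fmem le (w, size e) N s'].
have [| |y [u [r [Yy yu rq H]]]] := @game q D.
- move=> e v s t [H|[-> H]] ts; [left|right].
    exact: fmem_mono H ts.
  by split=> // s' w s't; apply: H; exact: Nm_le_trans ts.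
- move=> e s _ _.
  have [[t ts [v Hv]]|N'] :=
      pselect (exists2 t, le t s & exists v, fmem le (v, size e) N t).
    by exists t => //; exists v; left.
  exists s => //; exists r0; right; split=> // s' w s's Hw.
  by apply: N'; exists s' => //; exists w.
apply: (omega1_uncountable O_wo na).
have [_ /denumerable_countable] := Y_R Yy.
apply: sub_countable; apply: subset_card_le => b ob.
have ba : b < a.
  by rewrite ltNge; apply/negP => ab; apply: na; exact: omega1_down ob ab.
have [+ _] := dom b => /(_ r rq); rewrite fmem_check.
move=> /(_ ba r (Nm_le_refl r))[s sr [n bn]].
have [t ts [v [Dv vy]]] := H n s sr.
have bt := fmem_mono bn ts.
have e : b = v.
  move: Dv; rewrite /D /= size_mkseq => -[vt|[_ /(_ t b (Nm_le_refl t))//]].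
  by apply: (inj b v n t) => //; exact: Nm_le_trans ts (Nm_le_trans sr rq).
by rewrite e; apply: vy; rewrite -e.
Qed.

(** The tasks ask for the elements of the club members attached to the initial parts of the
    enumeration [u] of [y]. The limit of these members contains [y], and its countable ordinals are
    all in [y]. *)
Lemma fclub_meets (p : Nm) C : fclub le (check W) C p ->
  exists y q, [/\ Y y, le q p & exists x, [/\ fmem2 le x C q, fsub le (check y) x q &
    forall a r, le r q -> fmem le a x r -> omega1 a -> y a]].
Proof.
move=> Cp; have [x0 Wx0] := ctbl_subsets_neq0 omega1_lambda.
have [Phi [N [PhiN Phiinc]]] := fclub_family Nm_le_refl Nm_le_trans Cp Wx0.
(* If [code n = (m, k)], task [n] asks for term [k] of the member attached to the first [m] points.
   The ignored third coordinate makes each pair recur arbitrarily late, so that task [n] contains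
   these [m] points. *)
pose code n : nat * nat :=
  if @unpickle (nat * nat * nat)%type n is Some c then c.1 else (0, 0)%N.
have code_onto m k : exists2 n, (m <= n)%N & code n = (m, k).
  have inj : injective (fun j : nat => pickle (m, k, j)).
    by move=> j j' /(pcan_inj pickleK)[].
  have [j mj] := injective_gtn inj m.
  by exists (pickle (m, k, j)); [exact: ltnW|rewrite /code pickleK].
pose D (e : seq O) v : set Nm :=
  fmem le (v, (code (size e)).2) (N (take (code (size e)).1 e)).
have [| |y [u [q [Yy yu qp H]]]] := @game p D.
- by move=> e v r s; exact: fmem_mono.
- move=> e q eW qp; have [|B _] := PhiN (take (code (size e)).1 e).
    by move=> a /mem_take; exact: eW.
  exact: (fenum_tot (fbijection_enum B)).
have uW n : W (u n).
  have [RW _] := R_Pkl; have [yR _] := Y_R Yy.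
  by apply: RW; apply: yR; rewrite yu; exists n.
have mkW n a : a \in mkseq u n -> W a by move=> /mapP[i _ ->].
exists y, q; split=> //.
have [| |z [zC zsub zelim]] := @fclub_limit _ _ Nm_le_refl Nm_le_trans
  _ _ _ _ _ Cp (fun n => Phi (mkseq u n)).
- by move=> n; have [] := PhiN _ (mkW n).
- by move=> n; rewrite mkseqS; have [] := Phiinc _ (u n) (mkW n) (uW n).
exists z; split.
- by have [+ _] := stable_fmem_for (@feq _ le O) z C; apply; first exact: zC.
- move=> a r rq /fmem_check; rewrite yu => -[n _ <-].
  have rp := Nm_le_trans rq qp; apply: (zsub n.+1) => //; rewrite mkseqS.
  have [_ H'] := Phiinc _ (u n) (mkW n) (uW n).
  exact: fmem_mono H' rp.
- move=> a r rq az oa; have rp := Nm_le_trans rq qp.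
  have [s sr [m am]] := zelim a r rp az.
  have [B _] := PhiN _ (mkW m); have HB := fbijection_enum B.
  have [t ts [k ak]] := fenum_onto HB (Nm_le_trans sr rp) am.
  have [n mn cn] := code_onto m k.
  have [w wt [v [Dv vy]]] := H n t (Nm_le_trans ts (Nm_le_trans sr rq)).
  move: Dv; rewrite /D size_mkseq cn /=.
  have -> : take m (mkseq u n) = mkseq u m.
    by rewrite /mkseq -map_take take_iota (minn_idPl mn).
  move=> vk; have wp : le w p := Nm_le_trans wt (Nm_le_trans ts (Nm_le_trans sr rp)).
  have e := fenum_fun HB wp vk (fmem_mono ak wt).
  by rewrite -e; apply: vy; rewrite e.
Qed.

(** By [omega1_preserved], an ordinal countable in the extension is countable, so the club member
    [x] and [y] have the same countable ordinals there. *)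
Lemma family_forces (S : set (set O)) : Y `<=` S ->
  forces_semistationary le W S.
Proof.
move=> YS p C q qp Cq r rq.
have [y [s [Yy sr [x [xC yx xo]]]]] := fclub_meets (fclubW Nm_le_trans Cq rq).
exists s => //; exists x; split=> //; split.
  have [c1 _] := Cq; apply: c1 xC; exact: Nm_le_trans sr rq.
move=> t ts; exists t => //; exists (check y); split.
  by apply: (fmem2_check2 Nm_le_refl); exact: YS.
have yxt : fsub le (check y) x t.
  by have [+ _] := stable_fsub (check y) x; apply; first exact: yx.
split=> // a; split=> w wt [ay ao]; split=> //; first exact: yxt.
apply/fmem_check; apply: xo ay _; first exact: Nm_le_trans wt ts.
exact: omega1_preserved ao.
Qed.

End Family.

Lemma SSR_preserves :
  (forall nu : O, is_cardinal nu -> omega2 `<=` below nu -> nu < kappa ->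
     card_lt [set f : nat -> O | forall n, f n < nu] (below kappa)) ->
  SSR kappa lambda -> preserves_semistationary le W.
Proof.
move=> pow ssr S SW SS; have [R [RP oR _ SR]] := ssr S SW SS.
have [|Y [YS Ysm Ycl]] := small_semistationary pow RP oR _ SR.
  by move=> x [].
apply: (family_forces RP oR _ Ysm Ycl) => x /YS[] //.
Qed.

(** * The generic club *)

Local Notation shape := reflecting_shape.
Local Notation entry r n := (nth set0 (trunk r) n).

Lemma le_entry (p q : Nm) n : le q p -> (n < size (trunk p))%N ->
  (n < size (trunk q))%N /\ entry q n = entry p n.
Proof.
move=> /Nm_le_trunk pq np; split; first exact: leq_trans np (size_prefix pq).
exact: nth_prefix.
Qed.

Lemma extend (p : Nm) b : Pkl b ->
  exists q a, [/\ le q p, trunk q = rcons (trunk p) a & b `<=` a].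
Proof.
move=> pb; have [a sa ba] := @Succ_unbounded p b pb; exists (res p a), a.
by split=> //; [exact: res_le|exact: res_trunk].
Qed.

Lemma extend_size (p : Nm) n : exists2 q, le q p & (n < size (trunk q))%N.
Proof.
elim: n => [|n [q qp nq]].
  have [q [a [qp tq _]]] := extend p Pkl_set0; exists q => //.
  by rewrite tq size_rcons.
have [r [a [rq tr _]]] := extend q Pkl_set0; exists r; first exact: Nm_le_trans qp.
by rewrite tr size_rcons ltnS.
Qed.

(** The branching is unbounded because the sets of reflecting shape are cofinal. *)
Lemma shape_tree : tree_with_trunk [::]
  [set s | increasing_seq kappa lambda s /\ forall a, a \in s -> shape a].
Proof.
split.
- by move=> s [].
- move=> s u [[u1 u2] u3] su.
  have lt i : (i < size s)%N -> (i < size u)%N.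
    by move=> is_; exact: leq_trans is_ (size_prefix su).
  split; last by have /prefixP[v uE] := su; move=> a sa; apply: u3; rewrite uE mem_cat sa.
  split=> [i is_|i j ij js]; rewrite -!(nth_prefix _ su) //.
  + by apply: u1; exact: lt.
  + by apply: u2 => //; exact: lt.
  + exact: leq_ltn_trans js.
- by split=> //; split.
- by move=> s _; right; exact: prefix0s.
- move=> s [[s1 s2] s3] _ b pb.
  (* As sequences are increasing, a successor has to contain all entries of [s] besides [b]. *)
  have pU : Pkl (\bigcup_(i in [set: nat]) (nth set0 s i)).
    apply: Pkl_bigcup; first exact: small_countable.
    move=> i _; have [lt|ge] := ltnP i (size s); first exact: s1.
    by rewrite nth_default.
  have [R [RP oR Rk] bR] := reflecting_shape_cofinal
    (PklU pU pb).
  exists R; last by move=> c bc; apply: bR; right.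
  split; last by move=> a; rewrite mem_rcons inE => /orP[/eqP->|/s3].
  split=> [i|i j ij]; rewrite size_rcons ltnS leq_eqVlt.
    move=> /orP[/eqP->|lt]; first by rewrite nth_rcons ltnn eqxx.
    by rewrite nth_rcons lt; exact: s1.
  move=> /orP[/eqP e|lt].
    rewrite e in ij *; rewrite [X in _ `<=` X]nth_rcons ltnn eqxx nth_rcons.
    case: ltngtP ij => // [lt _|_ _]; last by rewrite ?eqxx.
    by move=> c ci; apply: bR; left; exists i.
  by rewrite !nth_rcons lt (leq_ltn_trans ij lt); exact: s2.
Qed.

Section GenericClub.
Variable h : set O -> seq O -> nat -> O.
Hypothesis h_preserved : forall R, shape R -> preserved (h R) R.

(** Trunks of stronger conditions list the generic sequence. Closure under [h R] for an entry [R]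
    concerns only arguments in [R], where [h R] is known to take values in [R]. *)
Definition generic_closed (x : name O) : set Nm :=
  [set p | forall q n (e : seq O) k, le q p -> (n < size (trunk q))%N ->
    (forall a, a \in e -> entry q n a /\ fmem le a x q) ->
    fmem le (h (entry q n) e k) x q].

Definition generic_club : name (name O) :=
  name_of (fun x => fand (fctbl_subset le (check W) x) (generic_closed x)).

Lemma stable_fctbl_subset (V x : name O) : stable le (fctbl_subset le V x).
Proof.
apply: stable_fand; first exact: stable_fsub.
exact: (stable_fdenumerable Nm_le_refl Nm_le_trans).
Qed.

Lemma stable_generic_closed x : stable le (generic_closed x).
Proof.
split=> [p q H qp r n e k rq|p H q n e k qp nq eq_].
  by apply: H; exact: Nm_le_trans rq qp.
have [_] := stable_fmem (h (entry q n) e k) x; apply=> r rq.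
have [s sr Hs] := H r (Nm_le_trans rq qp).
have sq := Nm_le_trans sr rq; have [ns <-] := le_entry sq nq; exists s => //.
apply: Hs => // a /eq_[qa ax]; split; first by have [_ ->] := le_entry sq nq.
exact: fmem_mono ax sq.
Qed.

Lemma fmem_generic_club x p : fmem2 le x generic_club p <->
  fctbl_subset le (check W) x p /\ generic_closed x p.
Proof.
apply: (@fmem2_name_of _ _ Nm_le_refl _
  (fun x => fand (fctbl_subset le (check W) x) (generic_closed x)))
  => [y|y z r yz [[yW yd] yc]].
  by apply: stable_fand; [exact: stable_fctbl_subset|exact: stable_generic_closed].
split; first split.
- by move=> a q qr za; apply: yW => //; apply/(feq_mem _ yz).
- exact: (fdenumerable_respects Nm_le_trans) yz yd.
- move=> q n e k qr nq eq_; apply/(feq_mem _ yz) => //; apply: yc => // a /eq_[? ?].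
  by split=> //; apply/(feq_mem _ yz).
Qed.

Section ClosureName.
Variables (p : Nm) (x : @name Nm O) (N : @name Nm (O * nat)) (c0 : O).
Hypothesis p_shape : forall q n, le q p -> (n < size (trunk q))%N -> shape (entry q n).
Hypothesis xW : fsub le x (check W) p.
Hypothesis xN : fbijection le x N p.
Hypothesis Wc0 : W c0.

(* v is the value of the term with code c among the terms of depth m over x;
   applying h outside its domain gives the junk value c0. *)
Fixpoint gen_term (m c : nat) (v : O) (r : Nm) : Prop :=
  if m isn't m'.+1 then fmem le (v, c) N r else
  match @unpickle (nat + nat * seq nat * nat)%type c with
  | Some (inl j) => gen_term m' j v r
  | Some (inr (n, l, k)) => (n < size (trunk r))%N /\ exists e : seq O,
      [/\ size e = size l,
          forall i, (i < size l)%N -> gen_term m' (nth 0 l i) (nth c0 e i) r &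
          v = if pselect (forall a, a \in e -> entry r n a) 
              then h (entry r n) e k else c0]
  | None => v = c0
  end.

Lemma gen_term_mono m c v r s : gen_term m c v r -> le s r -> gen_term m c v s.
Proof.
elim: m c v => [|m IH] c v /=; first exact: fmem_mono.
case: unpickle => [[j|[[n l] k]]|] //; first exact: IH.
move=> [nr [e [sz el ->]]] sr; have [ns ->] := le_entry sr nr; split=> //.
by exists e; split=> // i il; apply: IH sr; exact: el.
Qed.

Lemma gen_term_fun m c v v' r : le r p -> gen_term m c v r -> gen_term m c v' r -> v = v'.
Proof.
move=> rp; elim: m c v v' => [|m IH] c v v' /=.
  exact: (fenum_fun (fbijection_enum xN) rp).
case: unpickle => [[j|[[n l] k]]|]; [exact: IH| |by move=> -> ->].
move=> [_ [e [sz el ->]]] [_ [e' [sz' el' ->]]]; have -> // : e = e'.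
apply: (@eq_from_nth _ c0); first by rewrite sz.
by move=> i; rewrite sz => il; apply: IH (el i il) (el' i il).
Qed.

(** The arguments are decided one by one, and the trunk is then lengthened until it has an entry
    with index [n]. *)
Lemma gen_term_tot m c r : le r p -> exists2 s, le s r & exists v, gen_term m c v s.
Proof.
elim: m c r => [|m IH] c r rp /=.
  exact: (fenum_tot (fbijection_enum xN)).
case: unpickle => [[j|[[n l] k]]|]; [exact: IH| |by exists r => //; exists c0].
have [s sr [e [sz el]]] : exists2 s, le s r & exists e : seq O, size e = size l /\
    forall i, (i < size l)%N -> gen_term m (nth 0%N l i) (nth c0 e i) s.
  elim: l => [|j l [s sr [e [sz el]]]]; first by exists r => //; exists [::].
  have [t ts [v Hv]] := IH j s (Nm_le_trans sr rp).
  exists t; first exact: Nm_le_trans ts sr.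
  exists (v :: e); split=> /=; first by rewrite sz.
  by move=> [|i] //= il; apply: gen_term_mono ts; exact: el.
have [t ts nt] := extend_size s n.
exists t; first exact: Nm_le_trans ts sr.
eexists; split=> //; exists e; split=> [//|i il|//].
by apply: gen_term_mono ts; exact: el.
Qed.

Lemma gen_term_W m c v r : le r p -> gen_term m c v r -> W v.
Proof.
move=> rp; elim: m c v => [|m IH] c v /=.
  move=> H; have := fenum_sound (fbijection_enum xN) rp H.
  by move=> /(xW rp)/fmem_check.
case: unpickle => [[j|[[n l] k]]|]; [exact: IH| |by move=> ->].
move=> [nr [e [sz el ->]]]; case: pselect => //= eA.
have sh := p_shape rp nr; have [[AW _] _ _] := sh.
by apply: AW; apply: h_preserved.
Qed.

(** The closure of [x] under the functions of the generic sequence, possibly with [c0] added. *)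
Definition closure_name : @name Nm O :=
  name_of (fun a => fex le (fun mc : nat * nat => gen_term mc.1 mc.2 a)).

Lemma fmem_closure_name a r : fmem le a closure_name r <->
  fex le (fun mc : nat * nat => gen_term mc.1 mc.2 a) r.
Proof.
by apply: (fmem_name_of Nm_le_refl Nm_le_trans); exact: (stable_fex Nm_le_refl Nm_le_trans).
Qed.

Lemma sub_closure_name : fsub le x closure_name p.
Proof.
move=> a q qp xa; apply/fmem_closure_name => r rq.
have [|s sr [c Hc]] :=
    fenum_onto (fbijection_enum xN) (Nm_le_trans rq qp) (a := a).
  exact: fmem_mono xa rq.
by exists s => //; exists (0, c)%N.
Qed.

(** Pairs of a depth and a code enumerate the closure. Finitely many arguments get a common depth
    and condition by [gather], and the next depth applies [h] to them. *)
Lemma closure_name_club : fmem2 le closure_name generic_club p.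
Proof.
apply/fmem_generic_club; split; first split.
- move=> a q qp /fmem_closure_name /(_ q (Nm_le_refl q))[r rq [[m c] Hmc]].
  by apply/fmem_check; apply: gen_term_W Hmc; exact: Nm_le_trans rq qp.
- have dx : fdenumerable le x p.
    move=> q qp; exists q => //; exists N.
    have [+ _] := stable_fbijection Nm_le_refl Nm_le_trans x N.
    by apply; first exact: xN.
  pose dc c := odflt (0, 0)%N (@unpickle (nat * nat)%type c).
  apply: (fdenumerable_enum c0
    (E := fun c => gen_term (dc c).1 (dc c).2) _ dx); last exact: sub_closure_name.
  split.
  + by move=> c v r s; exact: gen_term_mono.
  + by move=> c v v' r; exact: gen_term_fun.
  + by move=> c r; exact: gen_term_tot.
  + move=> c v r rp H; apply/fmem_closure_name => s sr; exists s => //; exists (dc c).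
    exact: gen_term_mono sr.
  + move=> a r rp /fmem_closure_name /(_ r (Nm_le_refl r))[s sr [mc Hmc]].
    by exists s => //; exists (pickle mc); rewrite /dc pickleK.
- move=> q n e k qp nq eq_; apply/fmem_closure_name => r rq.
  have [| | | |s sr [m Hm]] := @gather _ le Nm_le_refl Nm_le_trans _
    (fun m a => [set s | exists c, gen_term m c a s]) e q _ _ _ r.
  + by move=> m a s t [c Hc] ts; exists c; exact: gen_term_mono ts.
  + move=> m a s [c Hc]; exists (pickle (inl c : nat + nat * seq nat * nat)).
    by rewrite /= pickleK.
  + move=> a /eq_[_ /fmem_closure_name H] s sq.
    by have [t ts [[m c] Hmc]] := H s sq; exists t => //; exists m, c.
  + exact: rq.
  exists s => //.
  have [l szl lP] : exists2 l : seq nat, size e = size l & forall i, (i < size l)%N ->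
      gen_term m (nth 0%N l i) (nth c0 e i) s.
    have /choice[f fP] : forall a, exists c, a \in e -> gen_term m c a s.
      move=> a; have [/Hm[c Hc]|_] := boolP (a \in e); first by exists c.
      by exists 0%N.
    exists (map f e); rewrite size_map // => i ie; rewrite (nth_map c0) //.
    by apply: fP; exact: mem_nth.
  exists (m.+1, pickle (inr (n, l, k) : nat + nat * seq nat * nat)) => /=.
  rewrite pickleK; have [ns en] := le_entry (Nm_le_trans sr rq) nq.
  split=> //; exists e; split=> //; rewrite en.
  by case: pselect => //= H; case: H => a /eq_[].
Qed.

End ClosureName.

(** Cofinality is given by [closure_name]. In an increasing union, finitely many arguments of [h]
    lie in one member. *)
Lemma generic_club_club (p : Nm) :
  (forall q n, le q p -> (n < size (trunk q))%N -> shape (entry q n)) ->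
  fclub le (check W) generic_club p.
Proof.
move=> psh; split; last split.
- by move=> x q qp /fmem_generic_club[].
- move=> x q qp xq r rq; exists r => //.
  have [xW xd] : fctbl_subset le (check W) x r.
    by have [+ _] := stable_fctbl_subset (check W) x; apply; first exact: xq.
  have [N xN] := fdenumerable_full xd.
  have [c0 oc0] := infinite_setN0 omega1_infinite.
  have Wc0 := omega1_lambda oc0.
  exists (closure_name N c0); split.
    apply: (@closure_name_club r x N c0) => // s n sr; apply: psh.
    exact: Nm_le_trans sr (Nm_le_trans rq qp).
  exact: sub_closure_name.
- move=> X q qp [XC Xinc] z s sq zP; apply/fmem_generic_club.
  have sX n : fmem2 le (section_name X n) generic_club s.
    have [+ _] := stable_fmem_for (@feq _ le O) (section_name X n) generic_club.
    by apply; first exact: (XC n).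
  have Xz n r a : le r s -> fmem le a (section_name X n) r -> fmem le a z r.
    move=> rs H; have [_ +] := zP a; apply=> // t tr; exists t => //; exists n.
    exact: fmem_mono H tr.
  have zX r a : le r s -> fmem le a z r ->
      exists2 t, le t r & exists n, fmem le a (section_name X n) t.
    by move=> rs H; have [+ _] := zP a => /(_ r rs H r (Nm_le_refl r)).
  split; first split.
  + move=> a r rs /(zX r a rs)[t tr [n an]]; have /fmem_generic_club[[sub _] _] := sX n.
    by have := sub a t (Nm_le_trans tr rs) an; rewrite !fmem_check.
  (* Bijections for all members are chosen at once; pairs of a member and an index then enumerate
     the union. *)
  + have /choice[N NP] : forall n, exists N, fbijection le (section_name X n) N s.
      move=> n; have /fmem_generic_club[[_ dn] _] := sX n.
      exact: fdenumerable_full.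
    have HN n := fbijection_enum (NP n).
    have /fmem_generic_club[[_ d0] _] := sX 0%N.
    pose dc c := odflt (0, 0)%N (@unpickle (nat * nat)%type c).
    apply: (fdenumerable_enum kappa
      (E := fun c v => fmem le (v, (dc c).2) (N (dc c).1)) _ d0);
      last by move=> a r rs; exact: Xz.
    split.
    * by move=> c v r t; exact: fmem_mono.
    * move=> c v v' r rs; exact: (fenum_fun (HN _) rs).
    * move=> c r rs; exact: (fenum_tot (HN _) _ rs).
    * by move=> c v r rs H; apply: (Xz (dc c).1) => //; exact: (fenum_sound (HN _) rs H).
    * move=> a r rs /(zX r a rs)[t tr [n an]].
      have [w wt [j Hj]] := fenum_onto (HN n) (Nm_le_trans tr rs) an.
      by exists w; [exact: Nm_le_trans wt tr|exists (pickle (n, j)); rewrite /dc pickleK].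
  + move=> r n e k rs nr er.
    have [_] := stable_fmem (h (entry r n) e k) z; apply=> t tr.
    have [| | | |w wt [m Hm]] := @gather _ le Nm_le_refl Nm_le_trans _
      (fun m a => [set w | le w s /\ fmem le a (section_name X m) w]) e r _ _ _ t.
    * move=> m a w w' [ws H] w'w; split; first exact: Nm_le_trans w'w ws.
      exact: fmem_mono H w'w.
    * move=> m a w [ws H]; split=> //; apply: (Xinc m) => //; exact: Nm_le_trans ws sq.
    * move=> a /er[_ az] w wr.
      have [|w' w'w [m Hm]] := zX w a (Nm_le_trans wr rs).
        exact: fmem_mono az wr.
      by exists w' => //; exists m; split=> //; exact: Nm_le_trans w'w (Nm_le_trans wr rs).
    * exact: tr.
    have wr := Nm_le_trans wt tr; have ws := Nm_le_trans wr rs.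
    exists w => //; apply: (Xz m) => //; have /fmem_generic_club[_ cl] := sX m.
    have [nw <-] := le_entry wr nr; apply: cl => // a ae; split; last by have [] := Hm a ae.
    by have [_ ->] := le_entry wr nr; have [] := er a ae.
Qed.

End GenericClub.

Lemma preserves_SSR : preserves_semistationary le W -> SSR kappa lambda.
Proof.
move=> pres S SW SS; apply: contrapT => nR.
(* No [R] of reflecting shape reflects [S], and [cl_semistationary] turns each failure into a
   function. *)
have /choice[h hP] : forall R : set O, exists h : seq O -> nat -> O, shape R ->
    preserved h R /\ forall y, S y -> y `<=` R -> ~ cl h y `&` omega1 `<=` y.
  move=> R; have [[RP oR Rk]|N] := pselect (shape R); last by exists (fun _ _ => kappa).
  apply: contrapT => nh; apply: nR; exists R; split=> //.
  have [x0 Rx0] := ctbl_subsets_neq0 oR.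
  apply: (cl_semistationary Rx0) => [y []//|h hR].
  apply: contrapT => ny; apply: nh; exists h => _; split=> // y Sy yR ycl.
  by apply: ny; exists y => //; split=> //; split=> //; have [] := SW y Sy.
pose p0 : Nm := Nm_of shape_tree.
have psh q n : le q p0 -> (n < size (trunk q))%N -> shape (entry q n).
  move=> qp nq; have [_] := qp _ (tree_trunk (trunkP q)); apply; exact: mem_nth.
have Ccl := generic_club_club
  (fun R sR => (hP R sR).1) psh.
have [r rp [x [xC [_ xy]]]] := pres S SW SS p0 _ p0 (Nm_le_refl p0) Ccl p0 (Nm_le_refl p0).
have [s sr [y [yS [yx yo]]]] := xy r (Nm_le_refl r).
have [t ts [y0 Sy0 yy0]] := fmem2_check2_elim Nm_le_refl yS.
have [y0W y0N] := SW y0 Sy0.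
(* Once [t] has decided that [y] is [y0], the next entry [a] can be taken to contain [y0]. *)
have [q [a [qt tq y0a]]] := extend t
  (Pkl_countable y0W (denumerable_countable y0N)).
have qs := Nm_le_trans qt ts; have qr := Nm_le_trans qs sr; have qp := Nm_le_trans qr rp.
have nq : (size (trunk t) < size (trunk q))%N by rewrite tq size_rcons.
have ea : entry q (size (trunk t)) = a by rewrite tq nth_rcons ltnn eqxx.
have sha : shape a by rewrite -ea; exact: psh.
have [hpres hno] := hP a sha; apply: (hno y0 Sy0 y0a) => b [clb ob].
have /fmem_generic_club[_ xcl] := xC.
(* The closure of [y0] under [h a] is formed inside [a], where [x] is forced to be closed. *)
have xa c : cl (h a) y0 c -> a c /\ fmem le c x q.
  elim=> {c} [c y0c|e k _ IH]; last first.
    split; first by apply: hpres => c /IH[].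
    rewrite -ea; apply: xcl => // c /IH; by rewrite ea.
  split; first exact: y0a.
  apply: yx => //; apply/(feq_mem _ yy0 qt).
  exact/fmem_check.
(* A countable ordinal of the closure lies in [x], hence in [y], hence in [y0], contrary to the
   choice of [h a]. *)
have [_ bx] := xa b clb; have [_ yob] := yo b.
have [|yb _] := yob q qs; last first.
  by move: yb => /(feq_mem _ yy0 qt)/fmem_check.
split=> //; exact: (fcountable_check Nm_le_refl Nm_le_trans).
Qed.

End Main.

Theorem theorem1p6 (d : Order.disp_t) (O : orderType d)
    (O_wo : well_ordered O) (kappa lambda : O)
    (kappa_reg : is_regular kappa) (lambda_reg : is_regular lambda)
    (aleph2_le_kappa : omega2 `<=` below kappa)
    (kappa_le_lambda : kappa <= lambda)
    (pow_lt_kappa : forall nu : O, is_cardinal nu ->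
       omega2 `<=` below nu -> nu < kappa ->
       card_lt [set f : nat -> O | forall n, f n < nu] (below kappa)) :
  preserves_semistationary (@Nm_le d O kappa lambda) (below lambda) <->
  SSR kappa lambda.
Proof.
split; first exact: preserves_SSR.
exact: SSR_preserves.
Qed.
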